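(* Assume that for all $i,j$ the function $c(\cdot,i,j)$ has finite support, that Assumption A holds, and that $m_1=\cdots=m_p=m>1$. Let $\mathcal C_m=\{\frac{u}{\Gamma_m^{-1}(u)\cdot u}:u\in\mathbb S^{d-1}\}$ be the limit curve of the sandpile with leakiness $m$, and let $$\mathcal X=\bigcup_{q=1}^{p}\ \bigcup_{i_1,\dots,i_q\in\{1,\dots,p\}}\left\{\frac{x_{1,2}+x_{2,3}+\cdots+x_{q,1}}{q}\ :\ x_{1,2}\in\operatorname{supp}\mu_{i_1,i_2},\dots,x_{q,1}\in\operatorname{supp}\mu_{i_q,i_1}\right\}$$ (for $q=1$: the points of $\operatorname{supp}\mu_{i_1,i_1}$). Then, as $m\to+\infty$, the rescaled shape $(\log m)\cdot\mathcal C_m$ converges to the convex hull of $\mathcal X$, uniformly in spherical coordinates: $$\sup_{u\in\mathbb S^{d-1}}\left|\frac{\log m}{\Gamma_m^{-1}(u)\cdot u}-h(u)\right|\longrightarrow0,\qquad h(u)=\max\{r\ge0: ru\in\operatorname{Conv}(\mathcal X)\}.$$ Consequently the region $\{ru:u\in\mathbb S^{d-1},\,0\le r\le \frac{\log m}{\Gamma_m^{-1}(u)\cdot u}\}$ converges to $\operatorname{Conv}(\mathcal X)$ in Hausdorff distance. In particular, in the uncolored case $p=1$, the limit is the convex hull of the support of $\mu=\mu_{1,1}$.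
   Context: Setting. $d,p\ge1$ are integers. For $x\in\mathbb Z^d$, $i,j\in\{1,\dots,p\}$ let $c(x,i,j)\ge 0$ (fixed, not depending on $m$), with $0<\sigma_i:=\sum_{(y,j)}c(y,i,j)<\infty$, and let $m_i\ge1$ be leakiness parameters. Put $\mu_{i,j}(x)=\frac{c(x,i,j)}{m_i\sigma_i}$. The killed random walk (KRW) $(X_n)$ on $(\mathbb Z^d\times\{1,\dots,p\})\sqcup\{\mathsf k\}$ jumps from $(x,i)$ to $(y,j)$ with probability $\mu_{i,j}(y-x)$ and from $(x,i)$ to the absorbing cemetery $\mathsf k$ with probability $1-\frac1{m_i}$. Assumption A: (1) $m_i>1$ for at least one $i$; (2) the KRW is irreducible: every $(x,j)$ can be reached from every $(0,i)$ with positive probability in some number $n\ge1$ of steps; (3) it is aperiodic: $\gcd\{n\ge1:\mathbb P_{(x,i)}(X_n=(x,i))>0\}=1$ for all $(x,i)$; (4) $\sum_{x}e^{\gamma\|x\|}\mu_{i,j}(x)<\infty$ for all $i,j$ and all $\gamma>0$. The supports $\operatorname{supp}\mu_{i,j}$ do not depend on $m$. The map $\Gamma_m$. For $t\in\mathbb R^d$ let $L\mu(t)$ be the $p\times p$ matrix with entries $\sum_{x\in\mathbb Z^d}e^{t\cdot x}\mu_{i,j}(x)$ and $\rho(t)$ its spectral radius (both depend on $m$ through $\mu$); $\partial\mathcal T=\{t:\rho(t)=1\}$. The map $\Gamma_m:\partial\mathcal T\to\mathbb S^{d-1}$, $\Gamma_m(t)=\nabla\rho(t)/\|\nabla\rho(t)\|$,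 is a homeomorphism (known result), and $\Gamma_m^{-1}(u)\cdot u>0$ for all $u\in\mathbb S^{d-1}$. The curve $\mathcal C_m$ delimits the limit shape, after scaling by $1/\log N$, of the leaky Abelian sandpile with toppling weights $c$ and leakiness $m$ started with $N\to\infty$ grains at the origin. *)

(* Defs.v *)
From mathcomp Require Import all_boot all_order all_algebra.
From mathcomp Require Import complex.
From mathcomp Require Import all_classical all_reals all_analysis.

Set Implicit Arguments.
Unset Strict Implicit.
Unset Printing Implicit Defensive.

Import Order.TTheory GRing.Theory Num.Theory.
Import numFieldNormedType.Exports.

Local Open Scope classical_set_scope.
Local Open Scope ring_scope.

(* The canonical norm of 'rV[R]_d in the library is the sup norm, hence the
   explicit Euclidean structure. *)
Definition dot (R : realType) (d : nat) (u v : 'rV[R]_d) : R :=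
  \sum_(k < d) u 0 k * v 0 k.

Definition enorm (R : realType) (d : nat) (u : 'rV[R]_d) : R :=
  Num.sqrt (dot u u).

Definition sphere (R : realType) (d : nat) : set 'rV[R]_d :=
  [set u | enorm u = 1].

Definition of_lattice (R : realType) (d : nat) (x : 'rV[int]_d) : 'rV[R]_d :=
  map_mx intr x.

Definition convex_hull (R : realType) (d : nat) (A : set 'rV[R]_d) :
    set 'rV[R]_d :=
  smallest (@convex_set R _) A.

Definition hausdorff_dist (R : realType) (d : nat) (A B : set 'rV[R]_d) :
    \bar R :=
  maxe (ereal_sup [set ereal_inf [set (enorm (a - b))%:E | b in B] | a in A])
       (ereal_sup [set ereal_inf [set (enorm (a - b))%:E | a in A] | b in B]).

Definition spectral_radius (R : realType) (p : nat) (A : 'M[R]_p) : R :=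
  sup [set ComplexField.Normc.normc z |
         z in [set z : complex R | eigenvalue (map_mx (real_complex R) A) z]].

Definition gradient (R : realType) (d : nat) (f : 'rV[R]_d -> R)
    (t : 'rV[R]_d) : 'rV[R]_d :=
  \row_(k < d) ('D_(delta_mx 0 k) f t).

Section Walk.
Context {R : realType} {d p : nat}.
Variables (c : 'rV[int]_d -> 'I_p -> 'I_p -> R) (m : 'I_p -> R).

Definition sigma (i : 'I_p) : \bar R :=
  \esum_(yj in [set: 'rV[int]_d * 'I_p]) (c yj.1 i yj.2)%:E.

Definition mu (i j : 'I_p) (x : 'rV[int]_d) : R :=
  c x i j / (m i * fine (sigma i)).

Definition supp_mu (i j : 'I_p) : set 'rV[int]_d := [set x | mu i j x != 0].

Record leaky_model : Prop := LeakyModel {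
  weight_ge0 : forall x i j, 0 <= c x i j ;
  sigma_gt0 : forall i, (0 < sigma i)%E ;
  sigma_fin : forall i, (sigma i < +oo)%E ;
  leakiness_ge1 : forall i, 1 <= m i }.

(* [None] is the cemetery. *)
Definition state : Type := option ('rV[int]_d * 'I_p).

Definition krw_step (a b : state) : R :=
  match a, b with
  | Some (x, i), Some (y, j) => mu i j (y - x)
  | Some (_, i), None => 1 - (m i)^-1
  | None, Some _ => 0
  | None, None => 1
  end.

(* [krw_prob n a b] is the probability that X_n = b when X_0 = a. *)
Fixpoint krw_prob (n : nat) (a b : state) : \bar R :=
  match n with
  | 0%N => (a == b)%:R%:E
  | n'.+1 => (\esum_(s in [set: state]) ((krw_step a s)%:E * krw_prob n' s b))%E
  end.

Definition irreducible_krw : Prop :=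
  forall (x : 'rV[int]_d) (i j : 'I_p), exists2 n : nat,
    (0 < n)%N & (0 < krw_prob n (Some (0%R, i)) (Some (x, j)))%E.

Definition aperiodic_krw : Prop :=
  forall (x : 'rV[int]_d) (i : 'I_p) (k : nat),
    (forall n : nat, (0 < n)%N ->
       (0 < krw_prob n (Some (x, i)) (Some (x, i)))%E -> (k %| n)%N) ->
    k = 1%N.

Definition exponential_moments : Prop :=
  forall (i j : 'I_p) (g : R), 0 < g ->
    (\esum_(x in [set: 'rV[int]_d])
        (expR (g * enorm (of_lattice R x)) * mu i j x)%:E < +oo)%E.

Record assumptionA : Prop := AssumptionA {
  leaky_somewhere : exists i, 1 < m i ;
  krw_irreducible : irreducible_krw ;
  krw_aperiodic : aperiodic_krw ;
  krw_moments : exponential_moments }.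

Definition Lmu (t : 'rV[R]_d) : 'M[R]_p :=
  \matrix_(i, j) fine (\esum_(x in [set: 'rV[int]_d])
    (expR (dot t (of_lattice R x)) * mu i j x)%:E).

Definition rho (t : 'rV[R]_d) : R := spectral_radius (Lmu t).

Definition boundaryT : set 'rV[R]_d := [set t | rho t = 1].

Definition Gamma (t : 'rV[R]_d) : 'rV[R]_d :=
  (enorm (gradient rho t))^-1 *: gradient rho t.

(* Inverse of the restriction of [Gamma] to [boundaryT]; 0 off its image. *)
Definition Gamma_inv : 'rV[R]_d -> 'rV[R]_d :=
  'pinv_(fun=> 0) boundaryT Gamma.

(* Means of the jumps along closed chains of at most p colours; [ordS] is the
   cyclic successor, so the last jump goes back to the first colour. *)
Definition cycle_means : set 'rV[R]_d :=
  [set v | exists (q : nat) (i : 'I_q -> 'I_p) (x : 'I_q -> 'rV[int]_d),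
     [/\ (1 <= q <= p)%N,
         forall k, supp_mu (i k) (i (ordS k)) (x k) &
         v = q%:R^-1 *: \sum_(k < q) of_lattice R (x k)]].

End Walk.

Definition ray (R : realType) (d : nat) (K : set 'rV[R]_d) (u : 'rV[R]_d) :
    set R :=
  [set r | 0 <= r /\ K (r *: u)].

(* A maximum as soon as the ray is nonempty and compact. *)
Definition radial (R : realType) (d : nat) (K : set 'rV[R]_d) (u : 'rV[R]_d) :
    R :=
  sup (ray K u).

Definition star_region (R : realType) (d : nat) (f : 'rV[R]_d -> R) :
    set 'rV[R]_d :=
  [set v | exists (u : 'rV[R]_d) (r : R),
     [/\ sphere u, 0 <= r <= f u & v = r *: u]].

(* Main.v *)
(* Write [rho = la / m], where [la t] is the Perron eigenvalue of the matrix with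
   entries [sum_x e^(t.x) c(x,i,j) / sigma_i], which does not depend on [m].
   Inserting the Perron vectors into the eigenvalue equation gives
   [la t + G t . (u - t) <= la u] with [G] continuous, so [G] is the gradient of
   [la]; hence [Gamma] maps [{la = m}] onto the sphere and [Gamma_inv u] maximises
   [_ . u] over [{la <= m}].  Multiplying the eigenvalue equation around cycles of
   colors compares [ln (la t)] with the support function [S] of the hull [K] of the
   cycle means: [S t - C <= ln (la t) <= S t].  By duality the maximum of [_ . u]
   over [{la <= m}] lies between [ln m / h u] and [(ln m + C) / h u], where
   [h] is the radial function of [K]; so the error is [O(1 / ln m)], uniformly
   in [u]. *)
Require Import Defs.
From mathcomp Require Import all_boot all_order all_algebra complex ring lra.
From mathcomp Require Import all_classical all_reals all_analysis.
Set Implicit Arguments.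
Unset Strict Implicit.
Unset Printing Implicit Defensive.
Import Order.TTheory GRing.Theory Num.Theory.
Import numFieldNormedType.Exports.
Local Open Scope classical_set_scope.
Local Open Scope ring_scope.

(** Differentiability of [la] rests on the continuity of its candidate gradient, hence of the Perron
    vectors. The obstacle is that [la - A] is singular exactly at the Perron value. Adding the
    all-ones matrix makes it invertible, and the normalised left Perron vector is then the all-ones
    row times this inverse. The constant [C] is [- ln alpha], where [alpha <= 1] bounds the positive
    normalised weights from below. It is the price of keeping a single term of the eigenvalue
    equation at each step of a cycle. The opposite bound has no such price: the weights out of a
    color sum to 1, so the equation is an average and some term is at least the mean. [Gamma_inv]
    selects an unspecified preimage, so the maximising property is proved for every preimage, and
    surjectivity of [Gamma] keeps the selection on the boundary. *)

Lemma continuous_bigsum (R : realType) (T : topologicalType) (I : Type)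
    (r : seq I) (P : pred I) (f : I -> T -> R) :
  (forall i, P i -> continuous (f i)) ->
  continuous (fun x => \sum_(i <- r | P i) f i x).
Proof.
move=> cf; apply: continuous_big => //.
exact: add_continuous.
Qed.

Lemma continuousMf (R : realType) (T : topologicalType) (f g : T -> R) :
  continuous f -> continuous g -> continuous (fun x => f x * g x).
Proof. by move=> cf cg x; apply: cvgM; [exact: cf|exact: cg]. Qed.

Lemma continuousMc (R : realType) (T : topologicalType) (f : T -> R) (k : R) :
  continuous f -> continuous (fun x => f x * k).
Proof. by move=> cf; apply: continuousMf => // x; exact: cvg_cst. Qed.

Lemma continuousBc (R : realType) (T : topologicalType) (f : T -> R) (k : R) :
  continuous f -> continuous (fun x => k - f x).
Proof. by move=> cf x; apply: cvgB; [exact: cvg_cst|exact: cf]. Qed.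

Lemma continuousVf (R : realType) (T : topologicalType) (f : T -> R) :
  (forall x, f x != 0) -> continuous f -> continuous (fun x => (f x)^-1).
Proof. by move=> f0 cf x; apply: cvgV; [exact: f0|exact: cf]. Qed.

Lemma continuous_compf (R : realType) (T : topologicalType) (g : R -> R) (f : T -> R) :
  continuous f -> continuous g -> continuous (fun x => g (f x)).
Proof. by move=> cf cg x; apply: (continuous_comp (cf x)); exact: cg. Qed.

Lemma closed_forall (T : topologicalType) (I : Type) (A : I -> set T) :
  (forall i, closed (A i)) -> closed [set x | forall i, A i x].
Proof.
move=> clA; rewrite (_ : mkset _ = \bigcap_(i in setT) A i).
  by apply: closed_bigI => i _.
by apply/seteqP; split=> [y y0 i _|y y0 i]; exact: y0.
Qed.

Lemma ler_term_sum (R : realType) (I : finType) (f : I -> R) i :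
  (forall j, 0 <= f j) -> f i <= \sum_j f j.
Proof. by move=> f0; rewrite (bigD1 i) //= lerDl sumr_ge0. Qed.

(** * Perron vectors of irreducible nonnegative matrices *)

Definition simplex (R : realType) (n : nat) : set 'rV[R]_n :=
  [set y | (forall i, 0 <= y 0 i) /\ \sum_i y 0 i = 1].

Lemma compact_simplex (R : realType) n : compact (@simplex R n).
Proof.
have box : compact [set y : 'rV[R]_n | forall i, `[0, 1]%classic (y ord0 i)].
  apply: (@rV_compact R n (fun=> `[0, 1]%classic)) => i; exact: segment_compact.
apply: (subclosed_compact _ box).
- apply: (@closedI _ [set y : 'rV[R]_n | forall i, 0 <= y 0 i]
                       [set y | \sum_i y 0 i = 1]).
    apply: closed_forall => i.
    apply: (preimage_closed (f := fun y : 'rV[R]_n => y 0 i) (D := [set x | 0 <= x])).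
      by move=> y _; exact: coord_continuous.
    exact: closed_ge.
  apply: (preimage_closed (f := fun y : 'rV[R]_n => \sum_i y 0 i) (D := [set x | x = 1])).
    move=> y _; apply: continuous_bigsum => i _; exact: coord_continuous.
  exact: closed_eq.
- move=> y [y0 y1] i; rewrite /= in_itv /= y0 -y1 /=.
  exact: (@ler_term_sum _ _ (fun i => y 0 i)).
Qed.

(* The exponent [k.+1] excludes the null 1x1 matrix. *)
Definition irreducible_mx (R : realType) n (A : 'M[R]_n.+1) :=
  forall i j, exists k, 0 < (A ^+ k.+1) i j.

Section Perron.
Context {R : realType} {n : nat}.
Implicit Types (A : 'M[R]_n.+1) (y z : 'rV[R]_n.+1).

Lemma ler_mulmx_row A y z : (forall i j, 0 <= A i j) ->
  (forall j, y 0 j <= z 0 j) -> forall j, (y *m A) 0 j <= (z *m A) 0 j.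
Proof.
by move=> A0 yz j; rewrite !mxE ler_sum // => i _; rewrite ler_wpM2r.
Qed.

Lemma mulmx_row_ge0 A y : (forall i j, 0 <= A i j) ->
  (forall j, 0 <= y 0 j) -> forall j, 0 <= (y *m A) 0 j.
Proof. by move=> A0 y0 j; rewrite mxE sumr_ge0 // => i _; rewrite mulr_ge0. Qed.

Lemma ler_mulmx_row_term A y i j : (forall i j, 0 <= A i j) ->
  (forall j, 0 <= y 0 j) -> y 0 i * A i j <= (y *m A) 0 j.
Proof.
move=> A0 y0; rewrite mxE.
by apply: (@ler_term_sum R _ (fun i => y 0 i * A i j)) => k; rewrite mulr_ge0.
Qed.

Lemma expmx_ge0 A k : (forall i j, 0 <= A i j) -> forall i j, 0 <= (A ^+ k) i j.
Proof.
move=> A0; elim: k => [|k IH] i j; first by rewrite expr0 mxE ler0n.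
by rewrite exprS mxE sumr_ge0 // => l _; rewrite mulr_ge0.
Qed.

Lemma superharmonic_exp A y mu k : (forall i j, 0 <= A i j) -> 0 <= mu ->
  (forall j, (y *m A) 0 j <= mu * y 0 j) ->
  forall j, (y *m A ^+ k) 0 j <= mu ^+ k * y 0 j.
Proof.
move=> A0 mu0 yA; elim: k => [|k IH] j; first by rewrite !expr0 mulmx1 mul1r.
rewrite exprS -[A * _]/(A *m _) mulmxA.
apply: (@le_trans _ _ ((mu *: y *m A ^+ k) 0 j)).
  apply: ler_mulmx_row; first exact: expmx_ge0.
  by move=> i; rewrite [leRHS]mxE.
by rewrite -scalemxAl mxE exprS -mulrA ler_wpM2l.
Qed.

(** Positivity propagates: some power of [A] carries the mass at [i] to [j], and iterating the
    inequality bounds this mass by a multiple of [y 0 j]. *)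
Lemma superharmonic_gt0 A y mu : (forall i j, 0 <= A i j) -> irreducible_mx A ->
  0 <= mu -> (forall j, 0 <= y 0 j) -> (exists j, 0 < y 0 j) ->
  (forall j, (y *m A) 0 j <= mu * y 0 j) -> forall j, 0 < y 0 j.
Proof.
move=> A0 irrA mu0 y0 [i yi] yA j; have [k Akij] := irrA i j.
rewrite lt_neqAle y0 andbT eq_sym; apply/eqP => yj.
have := superharmonic_exp k.+1 A0 mu0 yA j; rewrite yj mulr0 leNgt => /negP; apply.
apply: lt_le_trans (ler_mulmx_row_term i j (expmx_ge0 k.+1 A0) y0).
exact: mulr_gt0.
Qed.

Lemma exists_sum1 y : \sum_i y 0 i = 1 -> (forall j, 0 <= y 0 j) ->
  exists j, 0 < y 0 j.
Proof.
move=> y1 y0; apply/not_existsP => yle0.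
suff : \sum_i y 0 i <= 0 by rewrite y1 ler10.
by apply: sumr_le0 => i _; rewrite leNgt; apply/negP.
Qed.

(** Closedness is needed jointly in the factor and the vector, because [perron_vector] minimises the
    factor over such pairs. *)
Lemma closed_superharmonic A :
  closed [set x : R * 'rV[R]_n.+1 | forall j, (x.2 *m A) 0 j <= x.1 * x.2 0 j].
Proof.
have c2 i : continuous (fun x : R * 'rV[R]_n.+1 => x.2 0 i).
  move=> x; apply: (@continuous_comp _ _ _ snd (fun y : 'rV[R]_n.+1 => y 0 i)).
    exact: cvg_snd.
  exact: coord_continuous.
apply: (@closed_forall _ _ (fun j =>
  [set x : R * 'rV[R]_n.+1 | (x.2 *m A) 0 j <= x.1 * x.2 0 j])) => j.
have -> : [set x : R * 'rV[R]_n.+1 | (x.2 *m A) 0 j <= x.1 * x.2 0 j] =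
    [set x : R * 'rV[R]_n.+1 | 0 <= x.1 * x.2 0 j - \sum_i x.2 0 i * A i j].
  by apply/seteqP; split=> x /=; rewrite !mxE subr_ge0.
apply: (preimage_closed
  (f := fun x : R * 'rV[R]_n.+1 => x.1 * x.2 0 j - \sum_i x.2 0 i * A i j)
  (D := [set r | 0 <= r])); last exact: closed_ge.
move=> x _; apply: cvgB; first by apply: cvgM; [exact: cvg_fst|exact: c2].
have := @continuous_bigsum R (R * 'rV[R]_n.+1)%type 'I_n.+1 (index_enum _) xpredT
  (fun i x => x.2 0 i * A i j); apply => i _ {}x.
by apply: cvgM; [exact: c2|exact: cvg_cst].
Qed.

(** For each entry take a power of [A] that is positive there; the sum of these powers is positive
    and, as a polynomial in [A], commutes with [A]. *)
Lemma irreducible_smoothing A : (forall i j, 0 <= A i j) -> irreducible_mx A ->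
  exists2 B : 'M[R]_n.+1, (forall i j, 0 < B i j) & B *m A = A *m B.
Proof.
move=> A0 irrA; pose k i j := projT1 (cid (irrA i j)).
have Ak i j : 0 < (A ^+ (k i j).+1) i j by exact: projT2 (cid (irrA i j)).
exists (\sum_i \sum_j A ^+ (k i j).+1).
  move=> i j; rewrite summxE (bigD1 i) //= summxE (bigD1 j) //= -addrA ltr_pwDl //.
  apply: addr_ge0; first by apply: sumr_ge0 => l _; exact: expmx_ge0.
  apply: sumr_ge0 => l _; rewrite summxE sumr_ge0 // => l' _; exact: expmx_ge0.
rewrite -[LHS]/(_ * _) -[RHS]/(_ * _) mulr_suml mulr_sumr; apply: eq_bigr => i _.
rewrite mulr_suml mulr_sumr; apply: eq_bigr => j _.
by rewrite -exprSr -exprS.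
Qed.

Lemma strictly_superharmonic_lower A z mu :
  (forall j, 0 < z 0 j) -> (forall j, (z *m A) 0 j < mu * z 0 j) ->
  exists2 nu, nu < mu & forall j, (z *m A) 0 j <= nu * z 0 j.
Proof.
move=> z0 zA.
have := @Order.TotalTheory.arg_maxP _ _ 'I_n.+1 ord0 xpredT
  (fun j => (z *m A) 0 j / z 0 j) isT.
case=> j _ jmax; exists ((z *m A) 0 j / z 0 j); first by rewrite ltr_pdivrMr.
by move=> i; rewrite -ler_pdivrMr //; exact: jmax.
Qed.

(* [mu] is minimal such that [y A <= mu y] for some [y] of the simplex; if this
   inequality were strict somewhere, it would be strict everywhere for [y B], with
   [B] a positive matrix commuting with [A], and [mu] could be decreased. *)
Lemma perron_vector A : (forall i j, 0 <= A i j) -> irreducible_mx A ->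
  exists (mu : R) y, [/\ 0 < mu, forall j, 0 < y 0 j, \sum_j y 0 j = 1 &
    y *m A = mu *: y].
Proof.
move=> A0 irrA.
pose S := [set x : R * 'rV[R]_n.+1 |
  forall j, (x.2 *m A) 0 j <= x.1 * x.2 0 j].
(* [M] is an admissible factor for the uniform vector, since each column sum is at most [M]. This
   makes the search set nonempty and bounds the factor. *)
pose M := \sum_i \sum_j A i j.
pose K := (`[0, M]%classic `*` @simplex R n.+1) `&` S.
have cK : compact K.
  apply: (@subclosed_compact _ _ (`[0, M]%classic `*` @simplex R n.+1)).
  - apply: closedI; last exact: closed_superharmonic.
    apply: compact_closed; first exact: norm_hausdorff.
    by apply: compact_setX; [exact: segment_compact|exact: compact_simplex].
  - by apply: compact_setX; [exact: segment_compact|exact: compact_simplex].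
  - by move=> x [].
have K0 : K !=set0.
  have n0 : 0 < n.+1%:R^-1 :> R by rewrite invr_gt0 ltr0n.
  exists (M, const_mx n.+1%:R^-1); split.
    split=> /=.
      by rewrite in_itv /= lexx andbT; do 2!apply: sumr_ge0 => ? _.
    split=> [i|]; first by rewrite mxE ltW.
    under eq_bigr do rewrite mxE.
    by rewrite sumr_const card_ord -[LHS]mulr_natr mulVf // pnatr_eq0.
  move=> j /=; rewrite !mxE.
  under eq_bigr do rewrite mxE.
  rewrite -mulr_sumr mulrC ler_wpM2r ?(ltW n0) //.
  by apply: ler_sum => i _; exact: ler_term_sum.
have [] := @compact_EVT_min _ R (@fst R 'rV[R]_n.+1) K K0 cK.
  by apply: continuous_subspaceT => x; exact: cvg_fst.
move=> [mu y] /set_mem /= [[/= muM [y0 y1]] yA] mumin.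
have mu0 : 0 <= mu by move: muM; rewrite in_itv /= => /andP[].
have ygt0 := superharmonic_gt0 A0 irrA mu0 y0 (exists_sum1 y1 y0) yA.
have yE : y *m A = mu *: y.
  apply/rowP => j; have -> : (mu *: y) 0 j = mu * y 0 j by rewrite mxE.
  apply/eqP; rewrite eq_le yA /=.
  rewrite leNgt; apply/negP => ylt.
  have [B B0 BA] := irreducible_smoothing A0 irrA.
  pose z := y *m B.
  have zpos i : 0 < z 0 i.
    apply: lt_le_trans (ler_mulmx_row_term 0 i _ y0); first exact: mulr_gt0.
    by move=> ? ?; exact: ltW.
  have zA i : (z *m A) 0 i < mu * z 0 i.
    have : 0 < ((mu *: y - y *m A) *m B) 0 i.
      apply: lt_le_trans (ler_mulmx_row_term j i _ _).
      - by rewrite mulr_gt0 // !mxE subr_gt0; move: ylt; rewrite mxE.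
      - by move=> ? ?; exact: ltW.
      - by move=> l; move: (yA l); rewrite !mxE subr_ge0.
    by rewrite mulmxBl -mulmxA -BA mulmxA -scalemxAl !mxE subr_gt0.
  have [nu numu zAnu] := strictly_superharmonic_lower zpos zA.
  have nu0 : 0 <= nu.
    rewrite -(pmulr_lge0 _ (zpos 0)); apply: le_trans (zAnu 0).
    by apply: mulmx_row_ge0 => // i; exact: ltW.
  pose s := \sum_i z 0 i.
  have s0 : 0 < s by apply: lt_le_trans (ler_term_sum 0 (fun i => ltW (zpos i))).
  have : ((nu, s^-1 *: z) : R * 'rV[R]_n.+1) \in K.
    apply/mem_set; split; first split => /=.
    - rewrite in_itv /= nu0 (le_trans (ltW numu)) //.
      by move: muM; rewrite in_itv /= => /andP[].
    - split=> [i|]; first by rewrite mxE mulr_ge0 // ltW // invr_gt0.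
      under eq_bigr do rewrite mxE.
      by rewrite -mulr_sumr mulVf // gt_eqF.
    - move=> i /=; have -> : (s^-1 *: z) 0 i = s^-1 * z 0 i by rewrite mxE.
      rewrite -scalemxAl mxE mulrCA ler_wpM2l //.
      by rewrite invr_ge0 ltW.
  by move=> /mumin /=; rewrite leNgt numu.
exists mu, y; split => //.
(* A zero factor would make [y A^(k+1)] vanish, although some such power has a positive diagonal
   entry. *)
rewrite lt_neqAle mu0 andbT eq_sym; apply/eqP => mu_eq0.
have [k Ak] := irrA 0 0.
have := superharmonic_exp k.+1 A0 mu0 yA 0.
rewrite mu_eq0 expr0n mul0r leNgt => /negP; apply.
apply: lt_le_trans (ler_mulmx_row_term 0 0 (expmx_ge0 k.+1 A0) y0).
exact: mulr_gt0.
Qed.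

End Perron.

(** * Left and right Perron vectors, spectral radius and simplicity *)

Section SpectralRadius.
Context {R : realType} {n : nat}.
Implicit Types (A : 'M[R]_n.+1) (w r : 'rV[R]_n.+1).

(* Both eigenvectors are rows, so that [r] is a right eigenvector of [A]. *)
Definition perron_pair A (la : R) w r :=
  [/\ 0 < la, (forall j, 0 < w 0 j) /\ (forall j, 0 < r 0 j),
      \sum_j w 0 j = 1 /\ \sum_j r 0 j = 1, w *m A = la *: w & r *m A^T = la *: r].

Lemma perron_pair_trmx A la w r : perron_pair A la w r -> perron_pair A^T la r w.
Proof. by case=> ? [? ?] [? ?] ? ?; split => //; rewrite trmxK. Qed.

Lemma dot_trmx w r A : (w *m A *m r^T) 0 0 = (r *m A^T *m w^T) 0 0.
Proof. by rewrite -[in RHS]mulmxA -trmx_mul -[in RHS](trmxK r) -trmx_mul [RHS]mxE. Qed.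

Lemma mulmx_rowT w r : (w *m r^T) 0 0 = \sum_i w 0 i * r 0 i.
Proof. by rewrite mxE; apply: eq_bigr => i _; rewrite mxE. Qed.

Lemma mulmx_rowT_gt0 w r : (forall j, 0 < w 0 j) -> (forall j, 0 < r 0 j) ->
  0 < (w *m r^T) 0 0.
Proof.
move=> w0 r0; rewrite mulmx_rowT.
apply: (@lt_le_trans _ _ (w 0 0 * r 0 0)); first exact: mulr_gt0.
by apply: (ler_term_sum 0 (f := fun i => w 0 i * r 0 i)) => j; rewrite mulr_ge0 // ltW.
Qed.

Lemma irreducible_trmx A : irreducible_mx A -> irreducible_mx A^T.
Proof.
move=> irrA i j; have [k Ak] := irrA j i; exists k.
suff -> : A^T ^+ k.+1 = (A ^+ k.+1)^T by rewrite mxE.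
elim: k.+1 => [|m IH]; first by rewrite !expr0 trmx1.
by rewrite exprS IH exprSr -[A ^+ m * A]/(A ^+ m *m A) trmx_mul.
Qed.

(** [A] and its transpose come with eigenvalues that could differ a priori; computing [w A r^T] from
    either side identifies them, because [w r^T > 0]. *)
Lemma perron_pair_exists A : (forall i j, 0 <= A i j) -> irreducible_mx A ->
  exists (la : R) w r, perron_pair A la w r.
Proof.
move=> A0 irrA; have [la [w [la0 w0 w1 wA]]] := perron_vector A0 irrA.
have At0 i j : 0 <= A^T i j by rewrite mxE.
have [la' [r [la'0 r0 r1 rA]]] := perron_vector At0 (irreducible_trmx irrA).
exists la, w, r; split => //.
suff -> : la = la' by [].
have := dot_trmx w r A; rewrite wA rA -!scalemxAl [LHS]mxE [RHS]mxE.
rewrite [(r *m _) _ _]mulmx_rowT; under eq_bigr do rewrite mulrC.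
by rewrite -mulmx_rowT => /mulIf; apply; rewrite gt_eqF // mulmx_rowT_gt0.
Qed.

(* [|z| |x| <= |x| A] entrywise, and pairing with [r] gives [|z| <= la]. *)
Lemma spectral_radius_perron A la w r : (forall i j, 0 <= A i j) ->
  perron_pair A la w r -> spectral_radius A = la.
Proof.
move=> A0 [la0 [w0 r0] [w1 r1] wA rA].
pose E := [set ComplexField.Normc.normc z |
         z in [set z : complex R | eigenvalue (map_mx (real_complex R) A) z]].
have laE : E la.
  exists (la%:C)%C; last first.
    by rewrite /ComplexField.Normc.normc /= expr0n /= addr0 sqrtr_sqr gtr0_norm.
  apply/eigenvalueP; exists (map_mx (real_complex R) w).
    by rewrite -map_mxM wA map_mxZ.
  apply/eqP => /rowP /(_ 0); rewrite !mxE => /eqP; rewrite fmorph_eq0.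
  by rewrite gt_eqF.
have Ele y : E y -> y <= la.
  move=> [z /eigenvalueP [x xA x0] <-].
  pose N := @ComplexField.Normc.normc R.
  have N_ge0 t : 0 <= N t by case: t => a b; rewrite /N /= sqrtr_ge0.
  have N_M a b : N (a * b) = N a * N b by exact: ComplexField.Normc.normcM.
  have N_sum (f : 'I_n.+1 -> complex R) : N (\sum_i f i) <= \sum_i N (f i).
    elim/big_ind2 : _ => [||//]; first by rewrite /N ComplexField.Normc.normc0.
    move=> a b c d ab cd; apply: le_trans (lerD ab cd).
    exact: le_normcD.
  pose X : 'rV[R]_n.+1 := \row_j N (x 0 j).
  have zX j : N z * X 0 j <= (X *m A) 0 j.
    rewrite [X 0 j]mxE -N_M.
    have -> : z * x 0 j = (z *: x) 0 j by rewrite mxE.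
    rewrite -xA mxE [leRHS]mxE; apply: le_trans (N_sum _) _.
    apply: ler_sum => i _; rewrite N_M !mxE ler_wpM2l //.
    by rewrite /N /= expr0n /= addr0 sqrtr_sqr ger0_norm.
  have X0 j : 0 <= X 0 j by rewrite mxE.
  have Xr : 0 < (X *m r^T) 0 0.
    have [j xj] : exists j, x 0 j != 0.
      apply/not_existsP => xz; move/negP: x0; apply; apply/eqP/rowP => j.
      by rewrite mxE; apply/eqP; apply: contrapT => /negP; exact: xz.
    rewrite mulmx_rowT; apply: (@lt_le_trans _ _ (X 0 j * r 0 j)).
      rewrite mulr_gt0 // mxE lt_neqAle N_ge0 andbT eq_sym.
      by apply: contra xj => /eqP /ComplexField.Normc.eq0_normc ->.
    apply: (ler_term_sum j (f := fun i => X 0 i * r 0 i)) => i.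
    by rewrite mulr_ge0 // ltW.
  rewrite -(ler_pM2r Xr).
  have -> : la * (X *m r^T) 0 0 = (X *m A *m r^T) 0 0.
    rewrite dot_trmx rA -scalemxAl [RHS]mxE !mulmx_rowT; congr (_ * _).
    by apply: eq_bigr => i _; rewrite mulrC.
  rewrite !mulmx_rowT mulr_sumr; apply: ler_sum => i _.
  by rewrite mulrA ler_wpM2r // ltW.
apply/eqP; rewrite eq_le; apply/andP; split.
  by apply: ge_sup; [exists la|].
by apply: ub_le_sup => //; exists la.
Qed.

(** With [k] the least ratio [x_j / w_j], the eigenvector [x - k w] is nonnegative and has a zero
    coordinate, so by [superharmonic_gt0] it vanishes. *)
Lemma left_eigenvector_unique A la w r x : (forall i j, 0 <= A i j) ->
  irreducible_mx A -> perron_pair A la w r -> x *m A = la *: x ->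
  exists k, x = k *: w.
Proof.
move=> A0 irrA [la0 [w0 r0] [w1 r1] wA _] xA.
have := @Order.TotalTheory.arg_minP _ _ 'I_n.+1 ord0 xpredT
  (fun j => x 0 j / w 0 j) isT.
case=> j _ jmin; pose k := x 0 j / w 0 j; exists k.
pose y := x - k *: w.
have yE i : y 0 i = x 0 i - k * w 0 i by rewrite !mxE.
have yA i : (y *m A) 0 i <= la * y 0 i.
  by rewrite mulmxBl xA -scalemxAl wA scalerA mulrC -scalerA -scalerBr mxE.
have y0 i : 0 <= y 0 i.
  by rewrite yE subr_ge0 -ler_pdivlMr //; exact: jmin.
have yj : y 0 j = 0 by rewrite yE /k divfK ?subrr // gt_eqF.
apply/eqP; rewrite -subr_eq0 -/y; apply/eqP/rowP => i; rewrite [RHS]mxE; apply/eqP.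
apply: contraT => yi.
have := superharmonic_gt0 A0 irrA (ltW la0) y0 _ yA j.
rewrite yj ltxx; apply; exists i.
by rewrite lt_neqAle y0 andbT eq_sym.
Qed.

(** Pairing a left kernel vector [x] with [r] kills [la - A] and shows that [x] sums to 0. Then the
    all-ones matrix kills [x], so [x] is a multiple of [w]; as [w] sums to 1, the multiple is 0. *)
Lemma perron_shift_unit A la w r : (forall i j, 0 <= A i j) ->
  irreducible_mx A -> perron_pair A la w r ->
  la%:M - A + const_mx 1 \in unitmx.
Proof.
move=> A0 irrA P; have [la0 [w0 r0] [w1 r1] wA rA] := P.
rewrite -row_free_unit -kermx_eq0; apply/eqP/row_matrixP => i.
have : row i (kermx (la%:M - A + const_mx 1)) *m (la%:M - A + const_mx 1) = 0.
  by apply/sub_kermxP; rewrite row_sub.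
rewrite row0; move: (row i _) => x xB.
have xJ : x *m const_mx 1 = const_mx (\sum_j x 0 j) :> 'rV[R]_n.+1.
  by apply/rowP => j; rewrite !mxE; apply: eq_bigr => l _; rewrite mxE mulr1.
have Nr : (la%:M - A) *m r^T = 0.
  rewrite mulmxBl mul_scalar_mx -[A]trmxK -trmx_mul rA [in X in _ - X]linearZ /=.
  by rewrite subrr.
have s0 : \sum_j x 0 j = 0.
  have : (x *m (la%:M - A + const_mx 1) *m r^T) 0 0 = 0 by rewrite xB mul0mx mxE.
  rewrite -mulmxA mulmxDl Nr add0r mulmxA xJ mxE.
  under eq_bigr do rewrite !mxE.
  rewrite -mulr_sumr => /eqP; rewrite mulf_eq0 => /orP[/eqP //|].
  rewrite gt_eqF //; apply: lt_le_trans (ler_term_sum 0 _); first exact: r0.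
  by move=> j; exact: ltW.
have : x *m A = la *: x.
  apply/eqP; rewrite eq_sym -subr_eq0; apply/eqP.
  have := xB; rewrite mulmxDr xJ s0 mulmxBr mul_mx_scalar.
  by rewrite (_ : const_mx 0 = 0) ?addr0 //; apply/matrixP => ? ?; rewrite !mxE.
case/(left_eigenvector_unique A0 irrA P) => k xE.
move: s0; rewrite xE; under eq_bigr do rewrite mxE.
by rewrite -mulr_sumr w1 mulr1 => ->; rewrite scale0r.
Qed.

(** Pairing [B - A] with the left vector of [A] and the right vector of [B] leaves
    [(la' - la) w r'^T], and the normalised vectors have entries at most 1. *)
Lemma perron_value_dist A B la la' w r w' r' :
  perron_pair A la w r -> perron_pair B la' w' r' ->
  `|la' - la| * (w *m r'^T) 0 0 <= \sum_i \sum_j `|B i j - A i j|.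
Proof.
move=> [la0 [w0 r0] [w1 r1] wA rA] [la'0 [w'0 r'0] [w'1 r'1] wB rB].
have le1 (v : 'rV[R]_n.+1) j : (forall j, 0 < v 0 j) -> \sum_j v 0 j = 1 -> v 0 j <= 1.
  by move=> v0 <-; apply: (ler_term_sum j) => i; exact: ltW.
have -> : `|la' - la| * (w *m r'^T) 0 0 = `|(w *m (B - A) *m r'^T) 0 0|.
  rewrite -[X in _ * X]gtr0_norm ?mulmx_rowT_gt0 // -normrM; congr `|_|.
  rewrite mulmxBr mulmxBl wA -scalemxAl -[in RHS]mulmxA.
  rewrite -[B in RHS]trmxK -trmx_mul rB linearZ /= -scalemxAr.
  by rewrite -scalerBl [RHS]mxE.
rewrite mulmx_rowT; apply: le_trans (ler_norm_sum _ _ _) _.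
rewrite exchange_big /=; apply: ler_sum => j _.
rewrite normrM mxE -[leRHS]mulr1 ler_pM //.
  apply: le_trans (ler_norm_sum _ _ _) _; apply: ler_sum => i _.
  by rewrite !mxE normrM -[leRHS]mul1r ler_wpM2r // gtr0_norm // le1.
by rewrite gtr0_norm // le1.
Qed.

End SpectralRadius.

(** * Continuity of Perron values and vectors in a parameter *)

Lemma cvg_mul_bounded0 (R : realType) (T : topologicalType) (t : T) (f e : T -> R) :
  (forall s, `|f s| <= 1) -> e s @[s --> t] --> 0 -> f s * e s @[s --> t] --> 0.
Proof.
move=> f1 e0; apply: norm_cvg0.
have /cvg_norm := e0; rewrite normr0 => ne0.
apply: (squeeze_cvgr _ (cvg_cst 0) ne0); near=> s.
by rewrite normr_ge0 normrM -[leRHS]mul1r ler_wpM2r.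
Unshelve. all: by end_near. Qed.

Section PerronContinuity.
Context {R : realType} {n : nat} {T : topologicalType}.
Variables (M : T -> 'M[R]_n.+1) (la : T -> R) (w r : T -> 'rV[R]_n.+1).
Hypothesis M_ge0 : forall t i j, 0 <= M t i j.
Hypothesis M_irr : forall t, irreducible_mx (M t).
Hypothesis M_perron : forall t, perron_pair (M t) (la t) (w t) (r t).
Hypothesis M_cont : forall i j, continuous (fun t => M t i j).

(** In [perron_value_dist] the factor [w t (r s)^T] is at least the smallest entry of [w t],
    uniformly in [s], because [r s] sums to 1. *)
Lemma perron_value_continuous : continuous la.
Proof.
move=> t; have [la0 [w0 r0] _ _ _] := M_perron t.
have [k _ kmin] := @Order.TotalTheory.arg_minP _ _ 'I_n.+1 ord0 xpredT
  (fun j => w t 0 j) isT.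
pose D s := (w t 0 k)^-1 * \sum_i \sum_j `|M s i j - M t i j|.
have laD s : `|la s - la t| <= D s.
  rewrite /D mulrC ler_pdivlMr //.
  apply: le_trans (perron_value_dist (M_perron t) (M_perron s)).
  rewrite ler_wpM2l // mulmx_rowT.
  have [_ [_ rs0] [_ rs1] _ _] := M_perron s.
  rewrite -[leLHS]mulr1 -rs1 mulr_sumr; apply: ler_sum => i _.
  by rewrite ler_wpM2r // ?kmin // ltW.
have D0 : D s @[s --> t] --> 0.
  rewrite -[X in _ --> X](mulr0 (w t 0 k)^-1); apply: cvgM; first exact: cvg_cst.
  rewrite -[X in _ --> X](@big1 R 0 +%R 'I_n.+1 (index_enum _) xpredT (fun=> 0)) //.
  apply: cvg_big => // [|i _]; first exact: add_continuous.
  rewrite -[X in _ --> X](@big1 R 0 +%R 'I_n.+1 (index_enum _) xpredT (fun=> 0)) //.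
  apply: cvg_big => // [|j _]; first exact: add_continuous.
  rewrite -[X in _ --> X](normr0 R); apply: cvg_norm.
  rewrite -(subrr (M t i j)); apply: cvgB; [exact: M_cont|exact: cvg_cst].
have -> : la = (fun s => la s - la t + la t) by apply/funext => s; rewrite subrK.
rewrite /continuous_at; apply: cvgD; last exact: cvg_cst.
rewrite subrr; apply: norm_cvg0; apply: (squeeze_cvgr _ (cvg_cst 0) D0); near=> s.
by rewrite normr_ge0 laD.
Unshelve. all: by end_near. Qed.

(* With [J] the all-ones matrix, [w s *m (la t - M t + J)] tends to the all-ones
   row as [s] tends to [t], and the matrix is invertible. *)
Lemma perron_vector_continuous j : continuous (fun t => w t 0 j).
Proof.
move=> t; pose B : 'M[R]_n.+1 := (la t)%:M - M t + const_mx 1.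
have Bu : B \in unitmx by exact: (perron_shift_unit (@M_ge0 t) (@M_irr t) (M_perron t)).
have wB1 l : (w s *m B) 0 l @[s --> t] --> (1 : R).
  (* The shifted matrix at [s] sends [w s] exactly to the all-ones row; [e s] is the error from
     using the matrix at [t] instead. *)
  pose e s := \sum_i w s 0 i * (((la t - la s) *+ (i == l)) - (M t i l - M s i l)).
  have wBE s : (w s *m B) 0 l = 1 + e s.
    have [_ _ [ws1 _] wM _] := M_perron s.
    have -> : B = ((la t - la s)%:M - (M t - M s)) + ((la s)%:M - M s + const_mx 1).
      by apply/matrixP => i k; rewrite !mxE mulrnBl; ring.
    rewrite mulmxDr [X in X = _]mxE addrC; congr (_ + _).
      rewrite mulmxDr mulmxBr wM mul_mx_scalar subrr add0r mxE -[RHS]ws1.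
      by apply: eq_bigr => i _; rewrite mxE mulr1.
    by rewrite mxE; apply: eq_bigr => i _; rewrite !mxE.
  have -> : (fun s => (w s *m B) 0 l) = (fun s => 1 + e s) by exact/funext.
  suff : 1 + e s @[s --> t] --> (1 + 0 : R) by rewrite addr0.
  apply: cvgD; first exact: cvg_cst.
  rewrite -[X in _ --> X](@big1 R 0 +%R 'I_n.+1 (index_enum _) xpredT (fun=> 0)) //.
  apply: cvg_big => // [|i _]; first exact: add_continuous.
  apply: cvg_mul_bounded0 => [s|].
    have [_ [w0 _] [w1 _] _ _] := M_perron s.
    by rewrite gtr0_norm // -w1; apply: (ler_term_sum i) => k; exact: ltW.
  rewrite -(subrr (0 : R)); apply: cvgB.
    rewrite -(mul0rn _ (i == l)); apply: cvgMn.
    rewrite -(subrr (la t)); apply: cvgB; [exact: cvg_cst|exact: perron_value_continuous].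
  rewrite -(subrr (M t i l)); apply: cvgB; [exact: cvg_cst|exact: M_cont].
have wE s : w s 0 j = \sum_l (w s *m B) 0 l * invmx B l j.
  by rewrite -{1}(mulmxK Bu (w s)) mxE.
rewrite /continuous_at.
have -> : (fun s => w s 0 j) = (fun s => \sum_l (w s *m B) 0 l * invmx B l j).
  exact/funext.
have -> : w t 0 j = \sum_l 1 * invmx B l j.
  rewrite wE; apply: eq_bigr => l _; congr (_ * _).
  have [_ _ [wt1 _] wM _] := M_perron t.
  rewrite mulmxDr mulmxBr wM mul_mx_scalar subrr add0r mxE -[RHS]wt1.
  by apply: eq_bigr => i _; rewrite mxE mulr1.
apply: cvg_big => // [|l _]; first exact: add_continuous.
by apply: cvgM; [exact: wB1|exact: cvg_cst].
Qed.

End PerronContinuity.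

(** * Euclidean dot product and norm *)

Section Dot.
Context {R : realType} {d : nat}.
Implicit Types u v w : 'rV[R]_d.

Lemma dotE u v : dot u v = (u *m v^T) 0 0.
Proof. by rewrite mxE; apply: eq_bigr => k _; rewrite mxE. Qed.

Lemma dotC u v : dot u v = dot v u.
Proof. by apply: eq_bigr => k _; rewrite mulrC. Qed.

Lemma dotDl u v w : dot (u + v) w = dot u w + dot v w.
Proof. by rewrite !dotE mulmxDl mxE. Qed.

Lemma dotZl k u w : dot (k *: u) w = k * dot u w.
Proof. by rewrite !dotE -scalemxAl mxE. Qed.

Lemma dotNl u w : dot (- u) w = - dot u w.
Proof. by rewrite -scaleN1r dotZl mulN1r. Qed.

Lemma dotBl u v w : dot (u - v) w = dot u w - dot v w.
Proof. by rewrite dotDl dotNl. Qed.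

Lemma dot0l w : dot 0 w = 0.
Proof. by rewrite -(scale0r 0) dotZl mul0r. Qed.

Lemma dotDr u v w : dot w (u + v) = dot w u + dot w v.
Proof. by rewrite dotC dotDl !(dotC w). Qed.

Lemma dotBr u v w : dot w (u - v) = dot w u - dot w v.
Proof. by rewrite dotC dotBl !(dotC w). Qed.

Lemma dotZr k u w : dot w (k *: u) = k * dot w u.
Proof. by rewrite dotC dotZl dotC. Qed.

Lemma dot0r w : dot w 0 = 0.
Proof. by rewrite dotC dot0l. Qed.

Lemma dot_sumr I (r : seq I) (P : pred I) (F : I -> 'rV[R]_d) w :
  dot w (\sum_(i <- r | P i) F i) = \sum_(i <- r | P i) dot w (F i).
Proof.
by apply: (big_morph (dot w)) => [u v|]; [rewrite dotDr|rewrite dot0r].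
Qed.

Lemma dot_delta k w : dot (delta_mx 0 k) w = w 0 k.
Proof.
rewrite /dot (bigD1 k) //= big1 ?addr0; first by rewrite mxE !eqxx mul1r.
by move=> l /negbTE lk; rewrite mxE lk andbF mul0r.
Qed.

Lemma dot_ge0 u : 0 <= dot u u.
Proof. by apply: sumr_ge0 => k _; rewrite -expr2 sqr_ge0. Qed.

Lemma dot_eq0 u : (dot u u == 0) = (u == 0).
Proof.
apply/eqP/eqP => [u0|->]; last exact: dot0l.
apply/rowP => k; rewrite mxE; apply/eqP; rewrite -sqrf_eq0 eq_le sqr_ge0 andbT -u0.
rewrite expr2; apply: (ler_term_sum k (f := fun k => u 0 k * u 0 k)) => l.
by rewrite -expr2 sqr_ge0.
Qed.

Lemma dot_gt0 u : u != 0 -> 0 < dot u u.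
Proof. by move=> u0; rewrite lt_neqAle dot_ge0 andbT eq_sym dot_eq0. Qed.

Lemma enorm_ge0 u : 0 <= enorm u.
Proof. exact: sqrtr_ge0. Qed.

Lemma enorm_sqr u : enorm u ^+ 2 = dot u u.
Proof. by rewrite sqr_sqrtr // dot_ge0. Qed.

Lemma enorm_eq0 u : (enorm u == 0) = (u == 0).
Proof. by rewrite -sqrf_eq0 enorm_sqr dot_eq0. Qed.

Lemma enorm_gt0 u : u != 0 -> 0 < enorm u.
Proof. by move=> u0; rewrite lt_neqAle enorm_ge0 andbT eq_sym enorm_eq0. Qed.

Lemma enormZ k u : enorm (k *: u) = `|k| * enorm u.
Proof. by rewrite /enorm dotZl dotZr mulrA -expr2 sqrtrM ?sqr_ge0 // sqrtr_sqr. Qed.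

Lemma sphere_dot u : sphere u -> dot u u = 1.
Proof. by rewrite -enorm_sqr /sphere /= => ->; rewrite expr1n. Qed.

Lemma normalized_sphere u : u != 0 -> sphere ((enorm u)^-1 *: u).
Proof.
move=> u0; rewrite /sphere /= enormZ ger0_norm ?invr_ge0 ?enorm_ge0 //.
by rewrite mulVf // enorm_eq0.
Qed.

Lemma continuous_dotr w : continuous (fun u => dot u w).
Proof.
apply: continuous_bigsum => k _; apply: continuousMc; exact: coord_continuous.
Qed.

Lemma continuous_dot_sub v : continuous (fun u => dot (v - u) (v - u)).
Proof.
apply: continuous_bigsum => k _.
have cf : continuous (fun u : 'rV[R]_d => (v - u) 0 k).
  have -> : (fun u => (v - u) 0 k) = (fun u => v 0 k - u 0 k).
    by apply/funext => u; rewrite !mxE.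
  by apply: continuousBc; exact: coord_continuous.
exact: continuousMf.
Qed.

End Dot.

(** Combinatorial substitute for positive transition probabilities: only nonvanishing of weights
    matters, so irreducibility at one leakiness can be used at all others. *)
Inductive walk {R : realType} {d p : nat} (a : 'rV[int]_d -> 'I_p -> 'I_p -> R) :
    nat -> 'rV[int]_d -> 'I_p -> 'I_p -> Prop :=
  | walk0 i : walk a 0 0 i i
  | walkS k x y i j l : a x i j != 0 -> walk a k y j l -> walk a k.+1 (x + y) i l.

(** * The exponentially tilted jump matrix: gradient of its Perron value and cycle bounds *)

Section JumpMatrix.
Context {R : realType} {d n : nat}.
Variables (s : seq 'rV[int]_d) (a : 'rV[int]_d -> 'I_n.+1 -> 'I_n.+1 -> R).
Hypothesis a_ge0 : forall x i j, 0 <= a x i j.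
Hypothesis a_supp : forall x i j, a x i j != 0 -> x \in s.
Hypothesis a_sum1 : forall i, \sum_j \sum_(x <- s) a x i j = 1.
Hypothesis a_irr : forall x i j, exists k, walk a k.+1 x i j.

Local Notation lat := (@of_lattice R d).

Definition jump_mx (t : 'rV[R]_d) : 'M[R]_n.+1 :=
  \matrix_(i, j) \sum_(x <- s) expR (dot t (lat x)) * a x i j.

Lemma of_latticeD (x y : 'rV[int]_d) : lat (x + y) = lat x + lat y.
Proof. by rewrite /of_lattice map_mxD. Qed.

Lemma of_lattice0 : lat 0 = 0.
Proof. by rewrite /of_lattice map_mx0. Qed.

Lemma jump_mx_ge0 t i j : 0 <= jump_mx t i j.
Proof. by rewrite mxE; apply: sumr_ge0 => x _; rewrite mulr_ge0 ?expR_ge0. Qed.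

Lemma jump_mx_ge_term t x i j : expR (dot t (lat x)) * a x i j <= jump_mx t i j.
Proof.
have [->|axij] := eqVneq (a x i j) 0; first by rewrite mulr0 jump_mx_ge0.
rewrite mxE (big_rem x) /= ?(a_supp axij) // lerDl.
by apply: sumr_ge0 => y _; rewrite mulr_ge0 ?expR_ge0.
Qed.

Lemma jump_mx_walk t k x i j : walk a k x i j -> 0 < (jump_mx t ^+ k) i j.
Proof.
elim=> {k x i j} [i|k x y i j l axij _ IH]; first by rewrite expr0 mxE eqxx ltr01.
rewrite exprS mxE; apply: lt_le_trans (ler_term_sum j _).
  rewrite mulr_gt0 //; apply: lt_le_trans (jump_mx_ge_term t x i j).
  by rewrite mulr_gt0 ?expR_gt0 // lt_neqAle eq_sym axij a_ge0.
by move=> j'; rewrite mulr_ge0 ?jump_mx_ge0 // expmx_ge0 //; exact: jump_mx_ge0.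
Qed.

Lemma jump_mx_irr t : irreducible_mx (jump_mx t).
Proof.
by move=> i j; have [k wk] := a_irr 0 i j; exists k; exact: jump_mx_walk wk.
Qed.

Lemma jump_mx_perron : exists la (w r : 'rV[R]_d -> 'rV[R]_n.+1),
  forall t, perron_pair (jump_mx t) (la t) (w t) (r t).
Proof.
have H t : exists x, perron_pair (jump_mx t) x.1.1 x.1.2 x.2.
  have [l [w [r P]]] := perron_pair_exists (@jump_mx_ge0 t) (@jump_mx_irr t).
  by exists (l, w, r).
pose f t := projT1 (cid (H t)).
exists (fun t => (f t).1.1), (fun t => (f t).1.2), (fun t => (f t).2) => t.
exact: projT2 (cid (H t)).
Qed.

Lemma jump_mx_continuous i j : continuous (fun t => jump_mx t i j).
Proof.
have -> : (fun t => jump_mx t i j) =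
    (fun t => \sum_(x <- s) expR (dot t (lat x)) * a x i j).
  by apply/funext => t; rewrite mxE.
apply: continuous_bigsum => x _; apply: continuousMc; apply: continuous_compf.
  exact: continuous_dotr.
exact: continuous_expR.
Qed.

Section PerronData.
Variables (la : 'rV[R]_d -> R) (w r : 'rV[R]_d -> 'rV[R]_n.+1).
Hypothesis wrP : forall t, perron_pair (jump_mx t) (la t) (w t) (r t).

Let w_gt0 t i : 0 < w t 0 i. Proof. by have [_ [? _] _ _ _] := wrP t. Qed.
Let r_gt0 t i : 0 < r t 0 i. Proof. by have [_ [_ ?] _ _ _] := wrP t. Qed.
Lemma perron_value_gt0 t : 0 < la t. Proof. by have [] := wrP t. Qed.
Let wr_gt0 t : 0 < (w t *m (r t)^T) 0 0.
Proof. exact: mulmx_rowT_gt0. Qed.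

Let left_eq t j : \sum_i w t 0 i * jump_mx t i j = la t * w t 0 j.
Proof. by have [_ _ _ /rowP/(_ j) + _] := wrP t; rewrite !mxE. Qed.

Let right_eq t i : \sum_j jump_mx t i j * r t 0 j = la t * r t 0 i.
Proof.
have [_ _ _ _ /rowP/(_ i)] := wrP t; rewrite !mxE => <-.
by apply: eq_bigr => j _; rewrite [X in _ = _ * X]mxE mulrC.
Qed.

Lemma jump_value_continuous : continuous la.
Proof.
exact: (perron_value_continuous wrP jump_mx_continuous).
Qed.

Let w_continuous i : continuous (fun t => w t 0 i).
Proof.
exact: (perron_vector_continuous jump_mx_ge0 jump_mx_irr wrP jump_mx_continuous).
Qed.

Let r_continuous i : continuous (fun t => r t 0 i).
Proof.
apply: (@perron_vector_continuous R n _ (fun t => (jump_mx t)^T) la r w).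
- by move=> t k l; rewrite mxE; exact: jump_mx_ge0.
- by move=> t; apply: irreducible_trmx; exact: jump_mx_irr.
- by move=> t; exact: perron_pair_trmx.
- move=> k l; have -> : (fun t => (jump_mx t)^T k l) = (fun t => jump_mx t l k).
    by apply/funext => t; rewrite mxE.
  exact: jump_mx_continuous.
Qed.

(** Up to the factor [la t], the flow along a jump in the Doob transform of the tilted kernel by
    [r t], under the unnormalised stationary measure [w t * r t]. *)
Let flow t i j x := w t 0 i * (expR (dot t (lat x)) * a x i j) * r t 0 j.

Let flow_ge0 t i j x : 0 <= flow t i j x.
Proof. by rewrite !mulr_ge0 ?expR_ge0 // ltW. Qed.

Let flow_sum t i j : \sum_(x <- s) flow t i j x = w t 0 i * jump_mx t i j * r t 0 j.
Proof. by rewrite -mulr_suml -mulr_sumr mxE. Qed.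

(** The left equation evaluates the flow into a color, the right equation in [flow_out] the flow out
    of it; that the two totals agree is stationarity. *)
Let flow_in t (f : 'I_n.+1 -> R) :
  \sum_i \sum_j \sum_(x <- s) flow t i j x * f j = la t * \sum_j w t 0 j * r t 0 j * f j.
Proof.
rewrite exchange_big mulr_sumr; apply: eq_bigr => j _ /=.
rewrite !mulrA -left_eq !mulr_suml; apply: eq_bigr => i _.
by rewrite -mulr_suml flow_sum.
Qed.

Let flow_out t (f : 'I_n.+1 -> R) :
  \sum_i \sum_j \sum_(x <- s) flow t i j x * f i = la t * \sum_i w t 0 i * r t 0 i * f i.
Proof.
rewrite mulr_sumr; apply: eq_bigr => i _ /=.
transitivity (w t 0 i * (\sum_j jump_mx t i j * r t 0 j) * f i); last first.
  by rewrite right_eq; ring.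
rewrite mulr_sumr mulr_suml; apply: eq_bigr => j _.
by rewrite -mulr_suml flow_sum mulrA.
Qed.

(** The classical derivative of a simple eigenvalue, [w (dA) r / (w r)], where differentiating
    [e^(t.x)] brings down the factor [x]. *)
Definition perron_gradient t : 'rV[R]_d :=
  ((w t *m (r t)^T) 0 0)^-1 *:
    \sum_i \sum_j \sum_(x <- s) flow t i j x *: lat x.

Lemma dot_perron_gradient y t : dot y (perron_gradient t) =
  ((w t *m (r t)^T) 0 0)^-1 *
    \sum_i \sum_j \sum_(x <- s) flow t i j x * dot y (lat x).
Proof.
rewrite dotZr dot_sumr; congr (_ * _); apply: eq_bigr => i _.
rewrite dot_sumr; apply: eq_bigr => j _; rewrite dot_sumr; apply: eq_bigr => x _.
by rewrite dotZr.
Qed.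

(* With [f = ln (r u / r t)], the [r u]-eigenvalue equation weighted by the
   stationary measure [w t * r t] is an average of [exp (dot (u - t) x + f j - f i)];
   use [1 + y <= exp y], the [f]-terms cancelling by stationarity. *)
Lemma perron_gradient_le t u : la t + dot (u - t) (perron_gradient t) <= la u.
Proof.
pose N := (w t *m (r t)^T) 0 0; have N0 : 0 < N := wr_gt0 t.
pose f i := ln (r u 0 i / r t 0 i).
have NE : N = \sum_i w t 0 i * r t 0 i by exact: mulmx_rowT.
have Nu : N * la u = \sum_i \sum_j \sum_(x <- s) flow t i j x *
    expR (dot (u - t) (lat x) + f j - f i).
  rewrite NE mulr_suml; apply: eq_bigr => i _.
  transitivity (w t 0 i * r t 0 i / r u 0 i * (la u * r u 0 i)).
    by field; rewrite gt_eqF.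
  rewrite -right_eq mulr_sumr; apply: eq_bigr => j _.
  rewrite mxE mulr_suml mulr_sumr; apply: eq_bigr => x _.
  rewrite /flow expRD expRN expRD !lnK ?posrE ?divr_gt0 //.
  have -> : expR (dot u (lat x)) = expR (dot t (lat x)) * expR (dot (u - t) (lat x)).
    by rewrite -expRD dotBl addrC subrK.
  by field; rewrite !gt_eqF.
have Ng : N * dot (u - t) (perron_gradient t) =
    \sum_i \sum_j \sum_(x <- s) flow t i j x * dot (u - t) (lat x).
  by rewrite dot_perron_gradient mulVKf // gt_eqF.
rewrite -(ler_pM2l N0) mulrDr Ng Nu.
have -> : N * la t = \sum_i \sum_j \sum_(x <- s) flow t i j x * (1 + f j - f i).
  transitivity (\sum_i \sum_j \sum_(x <- s) (flow t i j x * 1) +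
      \sum_i \sum_j \sum_(x <- s) (flow t i j x * f j) -
      \sum_i \sum_j \sum_(x <- s) (flow t i j x * f i)).
    rewrite (flow_out t f) (flow_in t f) addrK (flow_in t (fun=> 1)) NE mulrC.
    by congr (_ * _); apply: eq_bigr => i _; rewrite mulr1.
  rewrite -big_split /= -sumrB; apply: eq_bigr => i _.
  rewrite -big_split /= -sumrB; apply: eq_bigr => j _.
  rewrite -big_split /= -sumrB; apply: eq_bigr => x _; ring.
rewrite -big_split; apply: ler_sum => i _ /=.
rewrite -big_split; apply: ler_sum => j _ /=.
rewrite -big_split; apply: ler_sum => x _ /=.
rewrite -mulrDr ler_wpM2l //; apply: le_trans (expR_ge1Dx _); lra.
Qed.

Lemma perron_gradient_continuous y : continuous (fun t => dot y (perron_gradient t)).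
Proof.
have -> : (fun t => dot y (perron_gradient t)) = (fun t =>
    (\sum_i w t 0 i * r t 0 i)^-1 *
    \sum_i \sum_j \sum_(x <- s) flow t i j x * dot y (lat x)).
  by apply/funext => t; rewrite dot_perron_gradient mulmx_rowT.
apply: continuousMf.
  apply: continuousVf => [t|]; first by rewrite -mulmx_rowT gt_eqF.
  by apply: continuous_bigsum => i _; apply: continuousMf.
apply: continuous_bigsum => i _; apply: continuous_bigsum => j _.
apply: continuous_bigsum => x _; apply: continuousMc; apply: continuousMf => //.
apply: continuousMf => //; apply: continuousMc; apply: continuous_compf.
  exact: continuous_dotr.
exact: continuous_expR.
Qed.

(** [perron_gradient_le] at both ends of the segment traps the difference quotient [q h] between
    [g 0] and [g h], and [g] is continuous. *)
Lemma perron_is_derive t y : is_derive t y la (dot y (perron_gradient t)).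
Proof.
pose q (h : R) := h^-1 *: (la (h *: y + t) - la t).
pose g (h : R) := dot y (perron_gradient (h *: y + t)).
have cg : g h @[h --> 0] --> g 0.
  apply: (@cvg_comp _ _ _ (fun h : R => h *: y + t)
    (fun u => dot y (perron_gradient u)) _ (nbhs (0 *: y + t))).
    apply: cvgD; last exact: cvg_cst.
    by apply: cvgZr_tmp; exact: cvg_id.
  exact: perron_gradient_continuous.
have qg (h : R) : h != 0 -> `|q h - g 0| <= `|g h - g 0|.
  move=> h0.
  have lo : h * g 0 <= la (h *: y + t) - la t.
    have := perron_gradient_le t (h *: y + t).
    by rewrite addrK dotZl /g scale0r add0r lerBrDl.
  have hi : la (h *: y + t) - la t <= h * g h.
    have := perron_gradient_le (h *: y + t) t.
    rewrite opprD addrCA subrr addr0 -scaleNr dotZl -/(g h) mulNr.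
    by rewrite lerBlDr => ?; rewrite lerBlDl.
  rewrite /q -[_ *: _]/(_ * _).
  have [hp|hn] : 0 < h \/ h < 0 by case: (ltgtP h 0) h0; auto.
    have lo' : g 0 <= h^-1 * (la (h *: y + t) - la t) by rewrite ler_pdivlMl.
    have hi' : h^-1 * (la (h *: y + t) - la t) <= g h by rewrite ler_pdivrMl.
    by rewrite !ger0_norm ?lerD2r ?subr_ge0 // (le_trans lo' hi').
  have lo' : g h <= h^-1 * (la (h *: y + t) - la t) by rewrite ler_ndivlMl.
  have hi' : h^-1 * (la (h *: y + t) - la t) <= g 0 by rewrite ler_ndivrMl.
  by rewrite !ler0_norm ?lerN2 ?lerD2r ?subr_le0 // (le_trans lo' hi').
have qc : q h @[h --> 0^'] --> g 0.
  apply/subr_cvg0; apply: norm_cvg0.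
  have g0 : `|g h - g 0| @[h --> 0^'] --> 0.
    suff /cvg_norm : g h - g 0 @[h --> 0^'] --> (0 : R) by rewrite normr0.
    apply/subr_cvg0; apply: (cvg_trans _ cg); apply: cvg_app; exact: nbhs_dnbhs.
  apply: (squeeze_cvgr _ (cvg_cst 0) g0); near=> h.
  by rewrite normr_ge0 qg //; near: h; exact: nbhs_dnbhs_neq.
apply: DeriveDef; first exact: (cvgP _ qc).
transitivity (g 0); last by rewrite /g scale0r add0r.
exact: (cvg_lim (@Rhausdorff R) qc).
Unshelve. all: by end_near. Qed.

Lemma perron_step_le (alpha : R) t x i j :
  (forall x i j, a x i j != 0 -> alpha <= a x i j) -> a x i j != 0 ->
  alpha * expR (dot t (lat x)) * r t 0 j <= la t * r t 0 i.
Proof.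
move=> alpha_le axij; rewrite -right_eq.
apply: le_trans (ler_term_sum j _); last first.
  by move=> l; rewrite mulr_ge0 ?jump_mx_ge0 // ltW.
rewrite ler_wpM2r // ?(ltW (r_gt0 _ _)) //.
apply: le_trans (jump_mx_ge_term t x i j).
by rewrite mulrC ler_wpM2l ?expR_ge0 // alpha_le.
Qed.

Lemma perron_walk_le (alpha : R) t k x i j : 0 <= alpha ->
  (forall x i j, a x i j != 0 -> alpha <= a x i j) -> walk a k x i j ->
  alpha ^+ k * expR (dot t (lat x)) * r t 0 j <= la t ^+ k * r t 0 i.
Proof.
move=> alpha0 alpha_le; elim=> {k x i j} [i|k x y i j l axij _ IH].
  by rewrite !expr0 of_lattice0 dot0r expR0 !mul1r.
rewrite of_latticeD dotDr expRD exprS.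
have -> : alpha * alpha ^+ k * (expR (dot t (lat x)) * expR (dot t (lat y))) * r t 0 l =
  alpha * expR (dot t (lat x)) * (alpha ^+ k * expR (dot t (lat y)) * r t 0 l) by ring.
apply: (@le_trans _ _ (alpha * expR (dot t (lat x)) * (la t ^+ k * r t 0 j))).
  by rewrite ler_wpM2l // mulr_ge0 ?expR_ge0.
rewrite mulrCA exprSr -mulrA ler_wpM2l ?exprn_ge0 ?(ltW (perron_value_gt0 t)) //.
exact: perron_step_le.
Qed.

(** Along a closed walk with displacement 0 the exponential and the entries of [r] cancel, which
    leaves a comparison of equal powers and a bound uniform in [t]. *)
Lemma perron_ge_weight (alpha : R) t : 0 <= alpha ->
  (forall x i j, a x i j != 0 -> alpha <= a x i j) -> alpha <= la t.
Proof.
move=> alpha0 alpha_le; have [k wk] := a_irr 0 ord0 ord0.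
have := perron_walk_le t alpha0 alpha_le wk.
rewrite of_lattice0 dot0r expR0 mulr1 ler_pM2r // ler_pXn2r ?nnegrE //.
exact: ltW (perron_value_gt0 t).
Qed.

(* A closed walk with displacement [x] bounds [dot t x] where [la t <= m]. *)
Lemma perron_coercive (alpha m : R) : 0 < alpha -> 1 <= m ->
  (forall x i j, a x i j != 0 -> alpha <= a x i j) ->
  forall x, exists B, forall t, la t <= m -> dot t (lat x) <= B.
Proof.
move=> alpha0 m1 alpha_le x; have [k wk] := a_irr x ord0 ord0.
exists (ln (m ^+ k.+1 / alpha ^+ k.+1)) => t tm.
have m0 : 0 < m by apply: lt_le_trans m1.
rewrite -ler_expR lnK ?posrE ?divr_gt0 ?exprn_gt0 // ler_pdivlMr ?exprn_gt0 // mulrC.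
have := perron_walk_le t (ltW alpha0) alpha_le wk; rewrite ler_pM2r // => le.
apply: le_trans le _; rewrite lerXn2r ?nnegrE ?(ltW (perron_value_gt0 t)) ?(ltW m0) //.
Qed.

(** At 0 the matrix is stochastic, so summing the left equation over colors suffices. This puts 0
    strictly inside every sublevel set with [m > 1]. *)
Lemma perron_value0 : la 0 = 1.
Proof.
have [_ _ [w1 _] _ _] := wrP 0.
rewrite -[LHS]mulr1 -{1}w1 mulr_sumr -{1}w1.
under eq_bigr do rewrite -left_eq.
rewrite exchange_big; apply: eq_bigr => i _ /=.
rewrite -mulr_sumr -[RHS]mulr1; congr (_ * _); rewrite -(a_sum1 i).
apply: eq_bigr => j _; rewrite mxE; apply: eq_bigr => x _.
by rewrite dot0l expR0 mul1r.
Qed.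

Definition cycle_in q (i : 'I_q -> 'I_n.+1) (x : 'I_q -> 'rV[int]_d) :=
  (1 <= q <= n.+1)%N /\ forall k, a (x k) (i k) (i (ordS k)) != 0.

Definition cycle_mean q (x : 'I_q -> 'rV[int]_d) : 'rV[R]_d :=
  q%:R^-1 *: \sum_(k < q) lat (x k).

Lemma expR_cycle_mean q (x : 'I_q -> 'rV[int]_d) t : (0 < q)%N ->
  expR (dot t (cycle_mean x)) ^+ q = \prod_(k < q) expR (dot t (lat (x k))).
Proof.
move=> q0; rewrite -expRM_natr dotZr dot_sumr mulrAC mulVf ?mul1r ?expR_sum //.
by rewrite pnatr_eq0 -lt0n.
Qed.

Lemma cycle_prod_cancel q (i : 'I_q -> 'I_n.+1) t :
  \prod_(k < q) r t 0 (i (ordS k)) = \prod_(k < q) r t 0 (i k).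
Proof.
rewrite [RHS](reindex_inj (h := @ordS q)) //.
exact: (can_inj (@ordSK q)).
Qed.

Lemma perron_ge_cycle (alpha : R) t q i (x : 'I_q -> 'rV[int]_d) : 0 <= alpha ->
  (forall x i j, a x i j != 0 -> alpha <= a x i j) -> cycle_in i x ->
  alpha * expR (dot t (cycle_mean x)) <= la t.
Proof.
move=> alpha0 alpha_le [/andP[q0 _] ix].
(* Each of the [q] steps costs one factor [alpha], and the [q]-th root restores a single [alpha], so
   the constant does not depend on the length of the cycle. *)
rewrite -(ler_pXn2r q0) ?nnegrE ?mulr_ge0 ?expR_ge0 ?(ltW (perron_value_gt0 t)) //.
have P0 : 0 < \prod_(k < q) r t 0 (i k) by apply: prodr_gt0.
rewrite -(ler_pM2r P0) exprMn expR_cycle_mean // -{1}cycle_prod_cancel.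
have cst (z : R) : z ^+ q = \prod_(k < q) z by rewrite prodr_const card_ord.
rewrite !cst -!big_split /=.
apply: ler_prod => k _; rewrite !mulr_ge0 ?expR_ge0 ?(ltW (r_gt0 _ _)) //=.
exact: perron_step_le.
Qed.

(** By the right equation, [la t * r t 0 i] is the mean of [e^(t.x) r_j] under the probability
    weights [a x i j], and a mean cannot exceed all the terms in its support. *)
Lemma exists_heavy_step t i : exists jx : 'I_n.+1 * 'rV[int]_d,
  a jx.2 i jx.1 != 0 /\ la t * r t 0 i <= expR (dot t (lat jx.2)) * r t 0 jx.1.
Proof.
apply: contrapT => H.
have lt_step j x : a x i j != 0 -> expR (dot t (lat x)) * r t 0 j < la t * r t 0 i.
  by move=> axij; rewrite ltNge; apply/negP => le; apply: H; exists (j, x).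
suff : la t * r t 0 i < la t * r t 0 i by rewrite ltxx.
rewrite -{1}right_eq -[ltRHS]mul1r -(a_sum1 i) mulr_suml.
(* Zero weights only give equalities; one positive weight is needed to make the sum strictly
   smaller. *)
have [j [x xs axij]] : exists j, exists2 x, x \in s & a x i j != 0.
  apply: contrapT => az; have := a_sum1 i; rewrite big1 => [/eqP|j _].
    by rewrite eq_sym oner_eq0.
  rewrite big_seq big1 // => x xs; apply/eqP; apply: contrapT => /negP axij.
  by apply: az; exists j, x.
have term_le k : jump_mx t i k * r t 0 k <= (\sum_(x <- s) a x i k) * (la t * r t 0 i).
  rewrite mxE !mulr_suml; apply: ler_sum => y _.
  have [->|ayk] := eqVneq (a y i k) 0; first by rewrite mulr0 !mul0r.
  by rewrite mulrAC mulrC ler_wpM2l // ltW // lt_step.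
rewrite (bigD1 j) // [ltRHS](bigD1 j) //= ltr_leD //; last exact: ler_sum.
rewrite mxE !mulr_suml (big_rem x) //= [ltRHS](big_rem x) //= ltr_leD //.
  by rewrite mulrAC mulrC ltr_pM2l ?lt_step // lt_neqAle eq_sym axij a_ge0.
apply: ler_sum => y _.
have [->|ayk] := eqVneq (a y i j) 0; first by rewrite mulr0 !mul0r.
by rewrite mulrAC mulrC ler_wpM2l // ltW // lt_step.
Qed.

(** Pigeonhole on [n.+2] iterates of [ord0]; the period is at most the number of colors, which is
    the length allowed in [cycle_means]. *)
Lemma exists_periodic (f : 'I_n.+1 -> 'I_n.+1) :
  exists i q, (1 <= q <= n.+1)%N /\ iter q f i = i.
Proof.
have : ~ injective (fun k : 'I_n.+2 => iter k f ord0).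
  by move=> /leq_card; rewrite !card_ord ltnn.
move=> /injectiveP /injectivePn [k [l kl kfl]].
wlog ltkl : k l kl kfl / (k < l)%N.
  move=> H; case: (ltngtP k l) => [|lk|/val_inj/eqP]; first exact: H.
    by apply: (H l k) => //; rewrite eq_sym.
  by rewrite (negbTE kl).
exists (iter k f ord0), (l - k)%N; rewrite subn_gt0 ltkl /= -iterD subnK ?(ltnW ltkl) //.
by split=> //; rewrite leq_subLR; apply: leq_trans (leq_addl _ _); rewrite -ltnS.
Qed.

(* Follow from each color a step [(j, x)] with [la r_i <= e^(t.x) r_j] until
   the colors repeat. *)
Lemma perron_le_cycle t : exists q i (x : 'I_q -> 'rV[int]_d),
  cycle_in i x /\ la t <= expR (dot t (cycle_mean x)).
Proof.
pose g i := projT1 (cid (exists_heavy_step t i)).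
have gP i : a (g i).2 i (g i).1 != 0 /\
    la t * r t 0 i <= expR (dot t (lat (g i).2)) * r t 0 (g i).1.
  exact: projT2 (cid (exists_heavy_step t i)).
have [i0 [q [/[dup] qn /andP[q0 _] qi]]] := exists_periodic (fun i => (g i).1).
pose i (k : 'I_q) := iter k (fun i => (g i).1) i0.
(* At the last index [ordS] wraps around to 0, and there the periodicity [qi] closes the cycle. *)
have iS k : i (ordS k) = (g (i k)).1.
  rewrite /i /= -[RHS]/(iter k.+1 (fun i => (g i).1) i0).
  have [kq|] := ltnP k.+1 q; first by rewrite modn_small.
  rewrite leq_eqVlt ltnNge ltn_ord orbF => /eqP kq.
  by rewrite -kq modnn [RHS]qi.
exists q, i, (fun k => (g (i k)).2); split.
  by split=> // k; rewrite iS; have [] := gP (i k).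
rewrite -(ler_pXn2r q0) ?nnegrE ?expR_ge0 ?(ltW (perron_value_gt0 t)) //.
have P0 : 0 < \prod_(k < q) r t 0 (i k) by apply: prodr_gt0.
rewrite -(ler_pM2r P0) expR_cycle_mean // -{2}cycle_prod_cancel.
have cst (z : R) : z ^+ q = \prod_(k < q) z by rewrite prodr_const card_ord.
rewrite !cst -!big_split /=.
apply: ler_prod => k _; rewrite mulr_ge0 ?(ltW (r_gt0 _ _)) ?(ltW (perron_value_gt0 t)) //=.
by rewrite iS; have [] := gP (i k).
Qed.

End PerronData.
End JumpMatrix.

(** * Convex hulls of finite sets and strict separation *)

Section Convexity.
Context {R : realType} {d : nat}.
Implicit Types (A C K : set 'rV[R]_d) (u v : 'rV[R]_d).

Lemma convex_setP A : convex_set A <->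
  (forall u v (l : R), 0 <= l <= 1 -> A u -> A v -> A (l *: u + (1 - l) *: v)).
Proof.
split=> [cA u v l /andP[l0 l1] Au Av|cA u v l /set_mem Au /set_mem Av].
  exact: set_mem (cA u v (Itv01 l0 l1) (mem_set Au) (mem_set Av)).
by apply/mem_set/cA => //; rewrite ge0 le1.
Qed.

Lemma convex_convex_hull A : convex_set (convex_hull A).
Proof.
apply/convex_setP => u v l l01 Au Av C [cC AC].
by move/convex_setP : (cC); apply => //; [apply: Au|apply: Av].
Qed.

Lemma convex_hull_dot_le A u (b : R) : (forall v, A v -> dot u v <= b) ->
  forall v, convex_hull A v -> dot u v <= b.
Proof.
move=> Ab; apply: (smallest_sub (X := [set v | dot u v <= b])) => //.
apply/convex_setP => v v' l /andP[l0 l1] /= vb v'b.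
have -> : b = l * b + (1 - l) * b by ring.
by rewrite dotDr !dotZr lerD // ler_wpM2l // subr_ge0.
Qed.

(** Unnormalised weights let the induction pass to the tail of the list; a tail of total weight 0 is
    treated apart. *)
Lemma convex_combination A (I : Type) (s : seq I) (f : I -> R) (x : I -> 'rV[R]_d) :
  convex_set A -> (forall i, 0 <= f i) -> (forall i, A (x i)) ->
  0 < \sum_(i <- s) f i ->
  A ((\sum_(i <- s) f i)^-1 *: \sum_(i <- s) f i *: x i).
Proof.
move=> /convex_setP cA f0 Ax; elim: s => [|i s IH]; first by rewrite big_nil ltxx.
rewrite !big_cons; set S := \sum_(j <- s) f j; set X := \sum_(j <- s) _ => S0.
have : 0 <= S by apply: sumr_ge0.
rewrite le_eqVlt => /orP[/eqP S'0|S'0].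
  have fi0 : 0 < f i by move: S0; rewrite -S'0 addr0.
  have -> : X = 0.
    have {S'0} : S = 0 by [].
    rewrite /S /X; elim: (s) => [|j s' IHs]; first by rewrite !big_nil.
    rewrite !big_cons => /eqP; rewrite paddr_eq0 ?sumr_ge0 //.
    move=> /andP[/eqP -> /eqP /IHs ->].
    by rewrite scale0r addr0.
  by rewrite -S'0 !addr0 scalerA mulVf ?scale1r ?gt_eqF.
have -> : (f i + S)^-1 *: (f i *: x i + X) =
    (f i / (f i + S)) *: x i + (1 - f i / (f i + S)) *: (S^-1 *: X).
  rewrite scalerDr !scalerA; congr (_ *: _ + _ *: _); first by rewrite mulrC.
  by field; rewrite !gt_eqF.
apply: cA => //; last exact: IH.
by rewrite divr_ge0 ?(ltW S0) //= ler_pdivrMr // mul1r lerDl ltW.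
Qed.

Definition combination n (x : 'I_n -> 'rV[R]_d) (y : 'rV[R]_n) : 'rV[R]_d :=
  \sum_i y 0 i *: x i.

(** Turns the hull, defined as an intersection, into a continuous image of the compact simplex. *)
Lemma convex_hull_range n (x : 'I_n -> 'rV[R]_d) :
  convex_hull (range x) = combination x @` @simplex R n.
Proof.
apply/seteqP; split=> [|_ [y [y0 y1] <-]].
  apply: smallest_sub.
    apply/convex_setP => _ _ l /andP[l0 l1] [y [y0 y1] <-] [z [z0 z1] <-].
    exists (l *: y + (1 - l) *: z).
      split=> [i|]; first by rewrite !mxE addr_ge0 // mulr_ge0 // subr_ge0.
      under eq_bigr do rewrite !mxE.
      by rewrite big_split /= -!mulr_sumr y1 z1; ring.
    rewrite /combination !scaler_sumr -big_split; apply: eq_bigr => i _ /=.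
    have -> : (l *: y + (1 - l) *: z) 0 i = l * y 0 i + (1 - l) * z 0 i.
      by rewrite !mxE.
    by rewrite scalerDl !scalerA.
  move=> _ [i _ <-]; exists (delta_mx 0 i).
    split=> [j|]; first by rewrite mxE ler0n.
    rewrite (bigD1 i) //= big1 => [|j /negbTE ji]; last by rewrite mxE ji andbF.
    by rewrite mxE !eqxx addr0.
  rewrite /combination (bigD1 i) //= big1 => [|j /negbTE ji].
    by rewrite mxE !eqxx scale1r addr0.
  by rewrite mxE ji andbF scale0r.
rewrite /combination -[X in convex_hull _ X]scale1r -invr1 -y1.
apply: convex_combination => //; [exact: convex_convex_hull| |by rewrite y1].
by move=> i; apply: sub_gen_smallest; exists i.
Qed.

Lemma continuousZc (T : topologicalType) (f : T -> R) u :
  continuous f -> continuous (fun t => f t *: u).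
Proof. by move=> cf t; apply: cvgZr_tmp; exact: cf. Qed.

Lemma continuous_combination n (x : 'I_n -> 'rV[R]_d) : continuous (combination x).
Proof.
apply: continuous_big => [|i _]; first exact: add_continuous.
by apply: continuousZc; exact: coord_continuous.
Qed.

Lemma compact_convex_hull A : finite_set A -> compact (convex_hull A).
Proof.
move=> /finite_seqP [s ->].
have -> : [set` s] = range (fun i : 'I_(size s) => s`_i).
  apply/seteqP; split=> [v /= vs|_ [i _ <-]]; last exact: mem_nth.
  have vi : (index v s < size s)%N by rewrite index_mem.
  by exists (Ordinal vi) => //=; rewrite nth_index.
rewrite convex_hull_range; apply: continuous_compact; last exact: compact_simplex.
by apply: continuous_subspaceT; exact: continuous_combination.
Qed.

Lemma dot_subZ u v (e : R) : dot (u - e *: v) (u - e *: v) - dot u u =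
  e * (e * dot v v - 2 * dot u v).
Proof. by rewrite dotBl !dotBr !dotZl !dotZr (dotC v u); ring. Qed.

(* [u] is [v] minus its projection on [K]. *)
Lemma strict_separation K v : compact K -> convex_set K -> K !=set0 -> ~ K v ->
  exists u b, (forall k, K k -> dot u k <= b) /\ b < dot u v.
Proof.
move=> cK /convex_setP vK K0 Kv.
have [z /set_mem Kz zmin] := @compact_EVT_min _ R
  (fun k : 'rV[R]_d => dot (v - k) (v - k)) K K0 cK
  (continuous_subspaceT (@continuous_dot_sub R d v)).
pose u := v - z; exists u, (dot u z).
have u0 : u != 0.
  by rewrite subr_eq0; apply/eqP => vz; apply: Kv; rewrite vz.
split; last by rewrite -subr_gt0 -dotBr dot_gt0.
move=> k Kk; rewrite -subr_le0 -dotBr.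
set b := dot u (k - z); set c := dot (k - z) (k - z).
have c0 : 0 <= c := dot_ge0 _.
have H (e : R) : 0 <= e <= 1 -> 0 <= e * (e * c - 2 * b).
  move=> e01; have /zmin : e *: k + (1 - e) *: z \in K by apply/mem_set/vK.
  have -> : v - (e *: k + (1 - e) *: z) = u - e *: (k - z).
    by rewrite /u; apply/rowP => j; rewrite !mxE; ring.
  by rewrite -subr_ge0 -/u dot_subZ.
rewrite leNgt; apply/negP => b0.
(* This step satisfies [0 < e <= 1] and [e * c <= b], so [e * c - 2 * b] is negative: moving from
   [z] towards [k] would come closer to [v]. *)
pose e := b / (b + c).
have bc0 : 0 < b + c by rewrite ltr_wpDr.
have e0 : 0 < e by rewrite divr_gt0.
have e1 : e <= 1 by rewrite ler_pdivrMr // mul1r lerDl.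
have := H e; rewrite e1 ltW // => /(_ isT); rewrite pmulr_rge0 // leNgt => /negP; apply.
have : e * c <= b by rewrite mulrAC ler_pdivrMr // ler_wpM2l ?(ltW b0) // lerDr ltW.
lra.
Qed.

Lemma compact_dot_bounded K : compact K -> exists2 B, 0 <= B &
  forall k, K k -> enorm k <= B.
Proof.
move=> cK; have [->|/set0P K0] := eqVneq K set0; first by exists 0.
have [z _ zmax] := @compact_EVT_max _ R (fun k : 'rV[R]_d => dot (0 - k) (0 - k)) K
  K0 cK (continuous_subspaceT (@continuous_dot_sub R d 0)).
exists (enorm z); first exact: enorm_ge0.
move=> k /mem_set /zmax; rewrite !sub0r.
have dotNN x : dot (- x) (- x) = dot x x.
  by rewrite -(scaleN1r x) dotZl dotZr; ring.
by rewrite !dotNN => le; rewrite /enorm ler_sqrt // dot_ge0.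
Qed.

End Convexity.

(** * From the killed walk to finite sums and walks *)

Lemma esum_seq (R : realType) (T : choiceType) (s : seq T) (f : T -> \bar R) :
  uniq s -> (forall x, (0 <= f x)%E) -> (forall x, f x != 0%E -> x \in s) ->
  (\esum_(x in [set: T]) f x = \sum_(x <- s) f x)%E.
Proof.
move=> us f0 fs; rewrite fsbig_seq // -esum_fset //.
rewrite [RHS]esum_mkcond; apply: eq_esum => x _; case: ifPn => // xs.
apply/eqP; apply: contraNT xs => /fs xs; exact/mem_set.
Qed.

Section Model.
Context {R : realType} {d p : nat}.
Variables (c : 'rV[int]_d -> 'I_p -> 'I_p -> R) (m0 : R).
Hypothesis m0_gt1 : 1 < m0.
Hypothesis model : leaky_model c (fun=> m0).
Hypothesis finite_support : forall i j, finite_set [set x | c x i j != 0].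

Let c_ge0 := weight_ge0 model.

Lemma exists_support : exists2 s : seq 'rV[int]_d, uniq s &
  forall x i j, c x i j != 0 -> x \in s.
Proof.
have : finite_set (\bigcup_(ij in [set: 'I_p * 'I_p]) [set x | c x ij.1 ij.2 != 0]).
  by apply: bigcup_finite => //; exact: finite_finset.
move=> /finite_seqP [s sE]; exists (undup s); first exact: undup_uniq.
move=> x i j cx; rewrite mem_undup.
have : [set` s] x by rewrite -sE; exists (i, j).
by [].
Qed.

Lemma sigmaE s : uniq s -> (forall x i j, c x i j != 0 -> x \in s) ->
  forall i, sigma c i = (\sum_j \sum_(x <- s) c x i j)%:E.
Proof.
move=> us cs i; rewrite /sigma.
rewrite (@esum_seq _ _ [seq (x, j) | x <- s, j <- index_enum 'I_p]).
- rewrite big_allpairs_dep /= exchange_big /= -sumEFin.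
  by apply: eq_bigr => j _; rewrite -sumEFin.
- by apply: allpairs_uniq => //; [exact: index_enum_uniq|move=> [? ?] [? ?]].
- by move=> x; rewrite lee_fin.
- move=> [x j] /= cx; apply/allpairsP; exists (x, j) => /=.
  by split=> //; [apply: cs cx|rewrite mem_index_enum].
Qed.

(** Reduces every leakiness to leakiness 1, where the weights out of a color sum to 1. *)
Lemma mu_leak (m : R) i j x : mu c (fun=> m) i j x = m^-1 * mu c (fun=> 1) i j x.
Proof. by rewrite /mu mul1r invfM mulrCA. Qed.

Lemma fine_sigma_gt0 i : 0 < fine (sigma c i).
Proof. by rewrite fine_gt0 // (sigma_gt0 model) (sigma_fin model). Qed.

Lemma mu_eq0 (m : R) i j x : m != 0 -> (mu c (fun=> m) i j x == 0) = (c x i j == 0).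
Proof.
move=> mn0; rewrite /mu mulf_eq0 invr_eq0 mulf_eq0 (negbTE mn0) /=.
by rewrite (gt_eqF (fine_sigma_gt0 i)) orbF.
Qed.

Lemma mu_ge0 (m : R) i j x : 0 < m -> 0 <= mu c (fun=> m) i j x.
Proof. by move=> m_gt0; rewrite /mu divr_ge0 // mulr_ge0 // ltW // fine_sigma_gt0. Qed.

Lemma sum_mu s : uniq s -> (forall x i j, c x i j != 0 -> x \in s) ->
  forall i, \sum_j \sum_(x <- s) mu c (fun=> 1) i j x = 1.
Proof.
move=> us cs i.
have S0 := fine_sigma_gt0 i; move: S0; rewrite /mu (sigmaE us cs) mul1r /= => S0.
under eq_bigr do rewrite -mulr_suml.
by rewrite -mulr_suml divff // gt_eqF.
Qed.

Lemma cycle_means_leak (m : R) : m != 0 ->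
  cycle_means c (fun=> m) = cycle_means c (fun=> 1).
Proof.
move=> mn0; have suppE i j : supp_mu c (fun=> m) i j = supp_mu c (fun=> 1) i j.
  by apply/seteqP; split=> x /=; rewrite /supp_mu /= !mu_eq0 ?oner_eq0.
rewrite /cycle_means; apply/seteqP; split=> v [q [i [x [q1 ix ->]]]];
  exists q, i, x; split=> // k; by [rewrite -suppE|rewrite suppE].
Qed.

Lemma krw_step_ge0 a b : 0 <= krw_step c (fun=> m0) a b.
Proof.
have m0_gt0 := lt_trans ltr01 m0_gt1.
case: a b => [[x i]|] [[y j]|] //=; first exact: mu_ge0.
by rewrite subr_ge0 invf_le1 // ltW.
Qed.

Lemma krw_prob_ge0 k a b : (0 <= krw_prob c (fun=> m0) k a b)%E.
Proof.
elim: k a => [|k IH] a /=; first by rewrite lee_fin ler0n.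
by apply: esum_ge0 => x _; rewrite mule_ge0 // lee_fin krw_step_ge0.
Qed.

Lemma krw_prob_cemetery k yj : krw_prob c (fun=> m0) k None (Some yj) = 0%E.
Proof.
elim: k => [|k IH] //=; apply: esum1 => -[z|] _ /=; first by rewrite mul0e.
by rewrite IH mule0.
Qed.

(** A positive sum over intermediate states has a nonzero term; that state is not the cemetery, from
    which no site is reached. *)
Lemma krw_prob_walk k x y i j :
  (0 < krw_prob c (fun=> m0) k (Some (x, i)) (Some (y, j)))%E ->
  walk (fun x i j => mu c (fun=> 1) i j x) k (y - x) i j.
Proof.
have m0_neq0 : m0 != 0 by rewrite gt_eqF // (lt_trans ltr01).
elim: k x i => [|k IH] x i /=.
  rewrite lte_fin; case: eqP => [[-> ->] _|_]; last by rewrite ltxx.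
  by rewrite subrr; exact: walk0.
move=> P0; have [z] : exists z, ((krw_step c (fun=> m0) (Some (x, i)) z)%:E *
    krw_prob c (fun=> m0) k z (Some (y, j)) != 0)%E.
  apply: contrapT => H; move: P0; rewrite esum1 ?ltxx // => z _.
  by apply/eqP; apply: contrapT => /negP zP; apply: H; exists z.
case: z => [[z l]|]; last by rewrite krw_prob_cemetery mule0 eqxx.
rewrite mule_eq0 negb_or /= => /andP[zx0 P1].
have -> : y - x = (z - x) + (y - z) by rewrite [RHS]addrC addrA subrK.
apply: (@walkS _ _ _ _ _ _ _ _ l).
  by move: zx0; rewrite eqe !mu_eq0 ?oner_eq0.
by apply: IH; rewrite lt_neqAle krw_prob_ge0 andbT eq_sym.
Qed.

Lemma LmuE s (m : R) t : uniq s -> (forall x i j, c x i j != 0 -> x \in s) -> 0 < m ->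
  Lmu c (fun=> m) t =
  \matrix_(i, j) \sum_(x <- s) expR (dot t (of_lattice R x)) * mu c (fun=> m) i j x.
Proof.
move=> us cs m_gt0; apply/matrixP => i j; rewrite !mxE (@esum_seq _ _ s) //.
- by rewrite sumEFin.
- by move=> x; rewrite lee_fin mulr_ge0 ?expR_ge0 ?mu_ge0.
- move=> x; rewrite eqe mulf_eq0 negb_or mu_eq0 ?(gt_eqF m_gt0) // => /andP[_]; exact: cs.
Qed.

End Model.

(** * Maximising linear forms over a sublevel set of a convex function *)

Section SupportPoint.
Context {R : realType} {d : nat}.
Variables (la : 'rV[R]_d -> R) (G : 'rV[R]_d -> 'rV[R]_d) (m : R).
Hypothesis G_le : forall t u, la t + dot (u - t) (G t) <= la u.
Hypothesis G_cont : forall y, continuous (fun t => dot y (G t)).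
Hypothesis la_cont : continuous la.
Hypothesis la0_lt : la 0 < m.
Hypothesis la_coercive : forall k, exists B, forall t, la t <= m -> `|t 0 k| <= B.

Lemma compact_sublevel : compact [set t | la t <= m].
Proof.
pose B k := projT1 (cid (la_coercive k)).
have BP k t : la t <= m -> `|t 0 k| <= B k := projT2 (cid (la_coercive k)) t.
have box : compact [set t : 'rV[R]_d | forall k, `[- B k, B k]%classic (t ord0 k)].
  apply: (@rV_compact R d (fun k => `[- B k, B k]%classic)) => k.
  exact: segment_compact.
apply: (subclosed_compact _ box) => [|t tm k].
  apply: (preimage_closed (f := la) (D := [set r | r <= m])); last exact: closed_le.
  by move=> t _; exact: la_cont.
by rewrite /= in_itv /= -ler_norml BP.
Qed.

Lemma gradient_neq0 t : la t = m -> G t != 0.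
Proof.
move=> tm; apply/eqP => Gt; have := G_le t 0.
by rewrite Gt dot0r addr0 tm leNgt la0_lt.
Qed.

(** The subgradient inequality puts the sublevel set in a half-space with normal [G t]; hence any
    preimage of [u] under the Gauss map is a maximiser. *)
Lemma gradient_support t u : la t = m -> (enorm (G t))^-1 *: G t = u ->
  forall s, la s <= m -> dot s u <= dot t u.
Proof.
move=> tm <- s sm; rewrite !dotZr ler_wpM2l ?invr_ge0 ?enorm_ge0 //.
have := G_le t s; rewrite dotBl tm => le; lra.
Qed.

(* If [t] maximises [dot _ u] on the sublevel set, a direction [y] with
   [dot y u > 0 > dot y (G t)] would lead to better points of the set. *)
Lemma exists_gradient_direction u : sphere u ->
  exists2 t, la t = m & (enorm (G t))^-1 *: G t = u.
Proof.
move=> u1.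
have [t /set_mem /= tm tmax] := @compact_EVT_max _ R (fun t : 'rV[R]_d => dot t u)
  [set t | la t <= m] (ex_intro _ 0 (ltW la0_lt)) compact_sublevel
  (continuous_subspaceT (@continuous_dotr R d u)).
have no_ascent y : 0 < dot y u -> la t < m \/ dot y (G t) < 0 -> False.
  move=> yu asc.
  have line (f : 'rV[R]_d -> R) : continuous f ->
      (fun e : R => f (e *: y + t)) @ (0 : R)^'+ --> f t.
    move=> cf; apply: cvg_at_right_filter.
    rewrite -[X in f X](add0r t) -[X in X + t](scale0r y).
    apply: (@cvg_comp _ _ _ (fun e : R => e *: y + t) f _ (nbhs (0 *: y + t))).
      apply: cvgD; last exact: cvg_cst.
      by apply: cvgZr_tmp; exact: cvg_id.
    exact: cf.
  have : \forall e \near (0 : R)^'+, la (e *: y + t) <= m.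
    case: asc => [tlt|yG].
      near=> e; apply: ltW; near: e.
      exact: (@cvgr_lt _ _ _ _ _ _ (line la (@la_cont))).
    have Gline : (fun e : R => dot y (G (e *: y + t))) @ (0 : R)^'+ --> dot y (G t).
      exact: (line (fun t => dot y (G t)) (@G_cont y)).
    near=> e.
    have Ge : dot y (G (e *: y + t)) < 0 by near: e; exact: (@cvgr_lt _ _ _ _ _ _ Gline).
    have e0 : 0 < e by near: e; exact: nbhs_right_gt.
    (* The inequality based at [t] bounds [la] from below along the ray. Based at the displaced
       point, where the gradient still pairs negatively with [y], it bounds [la] from above. *)
    have := G_le (e *: y + t) t.
    rewrite opprD addrCA subrr addr0 -scaleNr dotZl.
    have : 0 <= - e * dot y (G (e *: y + t)) by rewrite mulr_le0 ?oppr_le0 // ltW.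
    by move=> ? ?; apply: le_trans tm; lra.
  move=> H; have [e [em e0]] : exists e : R, la (e *: y + t) <= m /\ 0 < e.
    have /filter_ex [e He] : \forall e \near (0 : R)^'+, la (e *: y + t) <= m /\ 0 < e.
      by near=> e; split; near: e => //; exact: nbhs_right_gt.
    by exists e.
  have := tmax _ (mem_set em); rewrite dotDl dotZl.
  by rewrite gerDr leNgt mulr_gt0.
have tm' : la t = m.
  apply/eqP; rewrite eq_le tm leNgt; apply/negP => tlt.
  by apply: (no_ascent u); [rewrite sphere_dot|left].
exists t => //.
have G0 := enorm_gt0 (gradient_neq0 tm').
(* Chosen so that [dot y (G t)] is [- enorm (G t) * dot y u] and [dot y y] is
   [2 * enorm (G t) * dot y u]: either [y] is a forbidden ascent direction or [y] is zero. *)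
pose y := enorm (G t) *: u - G t.
have yuE : dot y u = enorm (G t) - dot (G t) u.
  by rewrite dotBl dotZl sphere_dot // mulr1.
have yG : dot y (G t) = - enorm (G t) * dot y u.
  by rewrite yuE dotBl dotZl -enorm_sqr (dotC u); ring.
have yu : dot y u <= 0.
  rewrite leNgt; apply/negP => yu; apply: (no_ascent y) => //; right.
  by rewrite yG mulNr oppr_lt0 mulr_gt0.
have yy : dot y y = enorm (G t) * dot y u *+ 2.
  by rewrite -[in LHS]/y {1}/y dotBl dotZl (dotC u) (dotC (G t) y) yG; ring.
have /eqP : y == 0.
  rewrite -dot_eq0 eq_le dot_ge0 andbT yy mulr2n.
  by have := mulr_ge0_le0 (ltW G0) yu; lra.
move/eqP; rewrite subr_eq0 => /eqP GE.
by rewrite -{2}GE scalerA mulVf ?scale1r // gt_eqF.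
Unshelve. all: by end_near. Qed.

End SupportPoint.

(** * Radial functions and Hausdorff distance *)

Section Radial.
Context {R : realType} {d : nat}.
Variable K : set 'rV[R]_d.
Hypotheses (K_compact : compact K) (K_convex : convex_set K) (K0 : K 0).

Lemma radial_max u : sphere u -> ray K u (radial K u) /\ ubound (ray K u) (radial K u).
Proof.
move=> u1; have [B B0 KB] := compact_dot_bounded K_compact.
have cray : compact (ray K u).
  apply: (subclosed_compact _ (@segment_compact R 0 B)) => [|r [r0 Kr]].
    apply: closedI; first exact: closed_ge.
    apply: (preimage_closed (f := fun r : R => r *: u) (D := K)).
      by move=> r _; apply: cvgZr_tmp; exact: cvg_id.
    by apply: compact_closed => //; exact: norm_hausdorff.
  by rewrite /= in_itv /= r0 /=; have := KB _ Kr; rewrite enormZ u1 mulr1 ger0_norm.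
have ray0 : ray K u 0 by rewrite /ray /= scale0r.
have [r /set_mem rK rmax] := @compact_EVT_max _ R id (ray K u) (ex_intro _ 0 ray0) cray
  (continuous_subspaceT (fun x => cvg_id)).
have ub_r : ubound (ray K u) r by move=> z /mem_set /rmax.
suff -> : radial K u = r by [].
apply/eqP; rewrite eq_le ge_sup //=; last by exists 0.
by apply: ub_le_sup => //; exists r.
Qed.

Lemma radial_ge0 u : sphere u -> 0 <= radial K u.
Proof. by move=> /radial_max [[]]. Qed.

Lemma radial_in u r : sphere u -> 0 <= r <= radial K u -> K (r *: u).
Proof.
move=> /radial_max [[h0 Kh] _] /andP[r0 rh].
have [h_eq0|hn0] := eqVneq (radial K u) 0.
  have -> : r = 0 by apply/eqP; rewrite eq_le r0 andbT -h_eq0.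
  by rewrite scale0r.
have h_gt0 : 0 < radial K u by rewrite lt_neqAle eq_sym hn0.
move: (K_convex) => /convex_setP cK; have := cK _ _ (r / radial K u) _ Kh K0.
rewrite scaler0 addr0 scalerA divfK //; apply.
by rewrite divr_ge0 //= ler_pdivrMr // mul1r.
Qed.

Lemma exists_polar (v : 'rV[R]_d) : v != 0 ->
  exists u r, [/\ sphere u, 0 <= r & v = r *: u].
Proof.
move=> v0; exists ((enorm v)^-1 *: v), (enorm v).
split; [exact: normalized_sphere|exact: enorm_ge0|].
by rewrite scalerA divff ?scale1r // enorm_eq0.
Qed.

(** Points are matched along their common ray, by cutting the radius off at the other radial
    function. *)
Lemma hausdorff_radial (f : 'rV[R]_d -> R) (e : R) (u0 : 'rV[R]_d) : sphere u0 ->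
  (forall u, sphere u -> 0 <= f u) ->
  (forall u, sphere u -> `|f u - radial K u| <= e) ->
  (0 <= hausdorff_dist (star_region f) K <= e%:E)%E.
Proof.
move=> u01 f0 fe.
have close (x y : R) (u : 'rV[R]_d) : sphere u -> enorm (x *: u - y *: u) = `|x - y|.
  by move=> u1; rewrite -scalerBl enormZ u1 mulr1.
have star_close (g1 g2 : 'rV[R]_d -> R) (u : 'rV[R]_d) (r : R) :
    sphere u -> 0 <= g2 u -> `|g1 u - g2 u| <= e ->
    0 <= r <= g1 u -> exists2 r', 0 <= r' <= g2 u & `|r - r'| <= e.
  move=> u1 g20 ge /andP[r0 rg].
  have [rle|rlt] := leP r (g2 u).
    by exists r; [rewrite r0|rewrite subrr normr0 (le_trans _ ge)].
  exists (g2 u); first by rewrite g20 lexx.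
  rewrite gtr0_norm ?subr_gt0 //; apply: le_trans ge.
  by apply: le_trans (ler_norm _); rewrite lerD2r.
(* Nonnegativity needs a point of the star region, here 0 on the ray of [u0], since the supremum of
   an empty set is [-oo]. *)
apply/andP; split.
  rewrite le_max; apply/orP; left.
  apply: (@le_trans _ _ (ereal_inf [set (enorm (0 - b))%:E | b in K])).
    by apply: le_ereal_inf_tmp => _ [b _ <-]; rewrite lee_fin enorm_ge0.
  apply: ereal_sup_ubound; exists 0 => //; exists u0, 0.
  by rewrite scale0r lexx f0.
rewrite ge_max; apply/andP; split; apply: ge_ereal_sup => _ [v vA <-].
  have [u [r [u1 rf ->]]] := vA.
  have [r' r'h rr'] := star_close f (radial K) u r u1 (radial_ge0 u1) (fe u u1) rf.
  apply: (@le_trans _ _ (enorm (r *: u - r' *: u))%:E).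
    by apply: ereal_inf_lbound; exists (r' *: u) => //; exact: radial_in.
  by rewrite close // lee_fin.
have [u [r [u1 r0 vE]]] : exists u r, [/\ sphere u, 0 <= r & v = r *: u].
  have [->|/exists_polar //] := eqVneq v 0.
  by exists u0, 0; rewrite scale0r.
have rh : 0 <= r <= radial K u.
  by rewrite r0 /=; have [_] := radial_max u1; apply; split => //; rewrite -vE.
have fe' : `|radial K u - f u| <= e by rewrite distrC fe.
have [r' r'f rr'] := star_close (radial K) f u r u1 (f0 u u1) fe' rh.
apply: (@le_trans _ _ (enorm (r' *: u - r *: u))%:E).
  by apply: ereal_inf_lbound; exists (r' *: u); [exists u, r'|rewrite vE].
by rewrite close // lee_fin distrC.
Qed.

End Radial.

(** * Duality between the support function and the radial function of the hull *)

Section ScaledRadius.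
Context {R : realType} {d : nat}.
Variables (la : 'rV[R]_d -> R) (K : set 'rV[R]_d) (C : R).
Hypotheses (K_compact : compact K) (K_convex : convex_set K) (K_neq0 : K !=set0).
Hypothesis la_gt0 : forall t, 0 < la t.
Hypothesis C_ge0 : 0 <= C.
Hypothesis la_bounded_below : forall t, - C <= ln (la t).
Hypothesis la_ge_support : forall t v, K v -> dot t v <= ln (la t) + C.
Hypothesis la_le_support : forall t, exists2 v, K v & ln (la t) <= dot t v.

(** If 0 were separated from [K], the support function, and with it [ln la], would tend to [-oo]
    along a ray. [N] is chosen so that [N * b] is [- (C + 1)], below the lower bound [- C]. *)
Lemma hull_contains0 : K 0.
Proof.
apply: contrapT => K0.
have [u [b [ub]]] := strict_separation K_compact K_convex K_neq0 K0.
rewrite dot0r => b0; pose N := (C + 1) / - b.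
have N0 : 0 < N by rewrite divr_gt0 ?oppr_gt0 // ltr_wpDl.
have [v Kv lv] := la_le_support (N *: u).
have := le_trans (la_bounded_below (N *: u)) lv; rewrite dotZl.
have : N * dot u v <= N * b by rewrite ler_pM2l // ub.
have -> : N * b = - (C + 1) by rewrite /N; field; rewrite lt_eqF.
lra.
Qed.

(** The first bound is kept in product form so that nothing is divided by [radial K u], which is
    only known to be nonnegative. *)
Lemma support_bounds (m : R) u t : 1 < m -> sphere u -> la t = m ->
  (forall s, la s <= m -> dot s u <= dot t u) ->
  radial K u * ln m <= ln m / dot t u * (ln m + C) /\
  0 <= ln m / dot t u <= radial K u.
Proof.
move=> m1 u1 tm tmax; have K0 := hull_contains0.
have lm : 0 < ln m by rewrite ln_gt0.
have [[h0 Kh] hmax] := radial_max K_compact K0 u1.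
(* Here [r u] lies outside [K]. A separating functional, rescaled so that it is at most [ln m] on
   [K], lies in the sublevel set, so its product with [u] is at most that of [t]. *)
have upper r : radial K u < r -> ln m <= r * dot t u.
  move=> hr; have r0 : 0 < r := le_lt_trans h0 hr.
  have Kr : ~ K (r *: u).
    by move=> Kr; have := hmax r (conj (ltW r0) Kr); rewrite leNgt hr.
  have [s0 [b [sb bs]]] := strict_separation K_compact K_convex K_neq0 Kr.
  have b0 : 0 <= b by rewrite -(dot0r s0) sb.
  (* [b] may be 0 and cannot serve as divisor; the midpoint is positive and still separates
     strictly. *)
  pose b' := (b + dot s0 (r *: u)) / 2.
  have b'0 : 0 < b' by rewrite /b'; lra.
  have bb' : b < b' by rewrite /b'; lra.
  have b's : b' < dot s0 (r *: u) by rewrite /b'; lra.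
  pose s := (ln m / b') *: s0.
  have tau0 : 0 < ln m / b' by rewrite divr_gt0.
  have sm : la s <= m.
    have [v Kv lv] := la_le_support s.
    rewrite -ler_ln ?posrE ?(lt_trans ltr01 m1) //; apply: le_trans lv _.
    rewrite dotZl mulrAC ler_pdivrMr // ler_pM2l //.
    exact: le_trans (sb v Kv) (ltW bb').
  have := tmax s sm; rewrite -(ler_pM2l r0); apply: le_trans.
  rewrite -dotZr dotZl mulrAC ler_pdivlMr // ler_pM2l //.
  exact: ltW.
have tu0 : 0 < dot t u.
  have := upper (radial K u + 1); rewrite ltrDl ltr01 => /(_ isT) le.
  have : 0 < (radial K u + 1) * dot t u := lt_le_trans lm le.
  by rewrite pmulr_rgt0 // ltr_wpDl.
split.
  (* The point [radial K u *: u] lies in [K], so its product with [t] is at most [ln m + C]. *)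
  rewrite mulrAC ler_pdivlMr // -mulrA (mulrC (ln m)) mulrA (mulrC _ (ln m)).
  by rewrite ler_pM2l // -tm -dotZr la_ge_support.
rewrite divr_ge0 ?(ltW lm) ?(ltW tu0) //=.
apply/ler_addgt0Pr => e e0; rewrite ler_pdivrMr //.
by apply: upper; rewrite ltrDl.
Qed.

End ScaledRadius.

(** * Limits in [m] and lower bounds on weights *)

Lemma cvg_ln_pinfty (R : realType) : ln m @[m --> +oo] --> (+oo : set_system R).
Proof.
apply/cvgryPge => A; near=> m.
have Am : expR A <= m by near: m; exact: nbhs_pinfty_ge.
by rewrite -ler_expR lnK // posrE (lt_le_trans (expR_gt0 A)).
Unshelve. all: by end_near. Qed.

Lemma cvg_le_inv_ln (R : realType) (F : R -> \bar R) (D : R) :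
  (forall m, 1 < m -> (0 <= F m <= (D / ln m)%:E)%E) -> F m @[m --> +oo] --> 0%E.
Proof.
move=> Fm; have Vln : (ln m)^-1 @[m --> (+oo : set_system R)] --> (0 : R).
  apply/gtr0_cvgV0; last exact: cvg_ln_pinfty.
  by near=> m; rewrite ln_gt0 //; near: m; exact: nbhs_pinfty_gt.
have D0 : (D / ln m)%:E @[m --> (+oo : set_system R)] --> 0%E.
  apply/cvg_EFin; first by near=> m.
  suff : D / ln m @[m --> (+oo : set_system R)] --> D * 0 by rewrite mulr0.
  by apply: cvgM => //; exact: cvg_cst.
apply: (squeeze_cvge _ (cvg_cst 0%E) D0).
by near=> m; apply: Fm; near: m; exact: nbhs_pinfty_gt.
Unshelve. all: by end_near. Qed.

Lemma exists_positive_weight_bound (R : realType) (d n : nat) (s : seq 'rV[int]_d)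
    (a : 'rV[int]_d -> 'I_n.+1 -> 'I_n.+1 -> R) :
  (forall x i j, 0 <= a x i j) -> (forall x i j, a x i j != 0 -> x \in s) ->
  exists2 alpha, 0 < alpha <= 1 & forall x i j, a x i j != 0 -> alpha <= a x i j.
Proof.
move=> a0 supp; pose S := \sum_i \sum_j \sum_(x <- s) (a x i j)^-1.
have S0 : 0 <= S by do 3!apply: sumr_ge0 => ? _; rewrite invr_ge0.
exists (1 + S)^-1.
  by rewrite invr_gt0 ltr_wpDr //= invf_le1 ?ltr_wpDr // lerDl.
move=> x i j axij; have axij0 : 0 < a x i j by rewrite lt_neqAle eq_sym axij a0.
rewrite -[leRHS]invrK lef_pV2 ?posrE ?invr_gt0 ?ltr_wpDr //.
apply: (@le_trans _ _ S); last by rewrite lerDr.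
apply: le_trans (ler_term_sum i _) => [|i']; last first.
  by do 2!apply: sumr_ge0 => ? _; rewrite invr_ge0.
apply: le_trans (ler_term_sum j _) => [|j']; last first.
  by apply: sumr_ge0 => ? _; rewrite invr_ge0.
rewrite (big_rem x) ?(supp x i j) //= lerDl.
by apply: sumr_ge0 => ? _; rewrite invr_ge0.
Qed.

Lemma perron_pairZ (R : realType) n (A : 'M[R]_n.+1) (k la : R) w r : 0 < k ->
  perron_pair A la w r -> perron_pair (k *: A) (k * la) w r.
Proof.
move=> k0 [la0 wr0 wr1 wA rA]; split => //; first exact: mulr_gt0.
  by rewrite -scalemxAr wA scalerA.
by rewrite linearZ /= -scalemxAr rA scalerA.
Qed.

(** * Assembly for the sandpile model *)

Section Main.
Context {R : realType} {d n : nat}.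
Variables (c : 'rV[int]_d -> 'I_n.+1 -> 'I_n.+1 -> R) (m0 : R).
Hypothesis m0_gt1 : 1 < m0.
Hypothesis model : leaky_model c (fun=> m0).
Hypothesis finite_support : forall i j, finite_set [set x | c x i j != 0].
Hypothesis irreducible : irreducible_krw c (fun=> m0).

Lemma finite_cycle_means : finite_set (cycle_means c (fun=> m0)).
Proof.
have [s us cs] := exists_support finite_support.
pose F q := range (fun f : {ffun 'I_q -> seq_sub s} =>
  @cycle_mean R d _ (fun k => val (f k))).
apply: (@sub_finite_set _ _ (\bigcup_(q in `I_n.+2) F q)).
  move=> _ [q [i [x [/andP[_ qn] ix ->]]]]; exists q => //.
  have xs k : x k \in s.
    apply: (cs _ (i k) (i (ordS k))); have := ix k.
    by rewrite /supp_mu /= (mu_eq0 model) // gt_eqF // (lt_trans ltr01).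
  exists [ffun k => SeqSub (xs k)] => //.
  by congr (_ *: _); apply: eq_bigr => k _; rewrite ffunE.
apply: bigcup_finite => [|q _]; first exact: finite_II.
apply: finite_image; exact: finite_finset.
Qed.

Let K := convex_hull (cycle_means c (fun=> m0)).

Lemma compact_hull : compact K.
Proof. exact: compact_convex_hull finite_cycle_means. Qed.

(** Collects what convex geometry needs from the walk. [la] and [C] are chosen before [m] and [u],
    which makes the final error uniform. *)
Lemma exists_support_functions : exists (la : 'rV[R]_d -> R) (C : R),
  [/\ forall t, 0 < la t /\ - C <= ln (la t), 0 <= C,
      forall t v, K v -> dot t v <= ln (la t) + C,
      forall t, exists2 v, K v & ln (la t) <= dot t v &
      forall m, 1 < m -> forall u, sphere u ->
        let t := Gamma_inv c (fun=> m) u in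
        la t = m /\ forall s, la s <= m -> dot s u <= dot t u].
Proof.
have [s us cs] := exists_support finite_support.
have m0_neq0 : m0 != 0 by rewrite gt_eqF // (lt_trans ltr01).
pose a x i j := mu c (fun=> 1) i j x.
have a0 x i j : 0 <= a x i j by exact: (mu_ge0 model).
have asupp x i j : a x i j != 0 -> x \in s.
  by rewrite /a (mu_eq0 model) ?oner_eq0 //; exact: cs.
have asum i : \sum_j \sum_(x <- s) a x i j = 1 by exact: (sum_mu model us cs).
have airr x i j : exists k, walk a k.+1 x i j.
  have [[|k] // _ /(krw_prob_walk m0_gt1 model)] := irreducible x i j.
  by rewrite subr0; exists k.
have [alpha /andP[alpha0 alpha1] alpha_le] := exists_positive_weight_bound a0 asupp.
have [la [w [r wrP]]] := jump_mx_perron a0 asupp airr.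
have la0 t : 0 < la t by case: (wrP t).
pose C := - ln alpha.
have cycleE q (i : 'I_q -> 'I_n.+1) x : cycle_in a i x ->
    cycle_means c (fun=> m0) (@cycle_mean R d _ x).
  move=> [qn ix]; rewrite (cycle_means_leak model m0_neq0).
  by exists q, i, x; split.
exists la, C; split.
- move=> t; split => //; rewrite opprK ler_ln ?posrE //.
  exact: (perron_ge_weight a0 asupp airr wrP t (ltW alpha0) alpha_le).
- by rewrite oppr_ge0 ln_le0.
- move=> t; apply: convex_hull_dot_le => v.
  rewrite (cycle_means_leak model m0_neq0) => -[q [i [x [qn ix ->]]]].
  have ix' : cycle_in a i x by split.
  have := perron_ge_cycle a0 asupp wrP t (ltW alpha0) alpha_le ix'.
  rewrite -ler_ln ?posrE ?mulr_gt0 ?expR_gt0 // lnM ?posrE ?expR_gt0 // expRK.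
  by rewrite -/(@cycle_mean R d _ x) /C; lra.
- move=> t; have [q [i [x [ix le]]]] := perron_le_cycle a0 asum wrP t.
  exists (@cycle_mean R d _ x); first by apply: sub_gen_smallest; exact: cycleE ix.
  by rewrite -ler_expR lnK ?posrE.
move=> m m1 u u1; have m_gt0 : 0 < m by apply: lt_trans m1.
pose G := perron_gradient s a w r.
have rhoE : rho c (fun=> m) = m^-1 \*: la.
  apply/funext => t; rewrite /rho.
  have -> : Lmu c (fun=> m) t = m^-1 *: jump_mx s a t.
    rewrite (LmuE model _ us cs m_gt0); apply/matrixP => i j; rewrite !mxE mulr_sumr.
    by apply: eq_bigr => x _; rewrite mu_leak mulrCA.
  apply: spectral_radius_perron; last first.
    by apply: perron_pairZ (wrP t); rewrite invr_gt0.
  move=> i j; rewrite mxE mulr_ge0 ?invr_ge0 ?(ltW m_gt0) //.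
  exact: jump_mx_ge0.
have gradE t : gradient (rho c (fun=> m)) t = m^-1 *: G t.
  apply/rowP => k; rewrite [LHS]mxE [RHS]mxE rhoE.
  have dla := perron_is_derive a0 asupp airr wrP t (delta_mx 0 k).
  by have [_ ->] := is_deriveZ m^-1 dla; rewrite dot_delta.
have GammaE t : Gamma c (fun=> m) t = (enorm (G t))^-1 *: G t.
  rewrite /Gamma gradE enormZ gtr0_norm ?invr_gt0 // scalerA invfM invrK.
  by rewrite mulrAC mulfV ?mul1r // gt_eqF.
have bdE t : boundaryT c (fun=> m) t <-> la t = m.
  rewrite /boundaryT /= rhoE /=; split=> [h|->]; last first.
    by rewrite -[_ *: _]/(_ * _) mulVf // gt_eqF.
  by rewrite -[RHS]mulr1 -h -[X in m * X]/(_ * _) mulVKf // gt_eqF.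
have G_le t t' : la t + dot (t' - t) (G t) <= la t' by exact: perron_gradient_le.
have surj : set_surj (boundaryT c (fun=> m)) (@sphere R d) (Gamma c (fun=> m)).
  move=> v v1; have [] := @exists_gradient_direction _ _ la G m G_le _ _ _ _ v v1.
  - move=> y.
    exact: (@perron_gradient_continuous _ _ _ s a a0 asupp airr la w r wrP y).
  - exact: (jump_value_continuous wrP).
  - by rewrite (perron_value0 asum wrP).
  - move=> k.
    (* A coordinate is the product with a unit lattice vector, so [perron_coercive] at this vector
       and at its opposite bounds it on both sides. *)
    have latE (z : int) t : dot t (of_lattice R (z *: delta_mx 0 k)) = z%:~R * t 0 k.
      have -> : of_lattice R (z *: delta_mx 0 k) = z%:~R *: delta_mx 0 k.
        by apply/rowP => l; rewrite !mxE; case: (_ && _); rewrite ?mulr1 ?mulr0.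
      by rewrite dotZr dotC dot_delta.
    have coercive := perron_coercive a0 asupp airr wrP alpha0 (ltW m1) alpha_le.
    have [B1 HB1] := coercive (1 *: delta_mx 0 k).
    have [B2 HB2] := coercive (- 1 *: delta_mx 0 k).
    exists (`|B1| + `|B2|) => t tm.
    have := HB1 t tm; have := HB2 t tm; rewrite !latE mulrN1z mul1r mulN1r => h1 h2.
    have := ler_norm B1; have := ler_norm B2; have := normr_ge0 B1; have := normr_ge0 B2.
    by rewrite ler_norml => *; apply/andP; split; lra.
  by move=> t tm tv; exists t; [exact/bdE|rewrite GammaE].
(* By surjectivity the partial inverse takes a genuine boundary point here and not its default value
   0. *)
have tm : la (Gamma_inv c (fun=> m) u) = m.
  by apply/bdE; apply: (surjpinv_image_sub (dflt := fun=> 0) surj); exists u.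
split=> //; apply: (gradient_support G_le tm).
by rewrite -GammaE; apply: (surjpK (fun=> 0) surj); exact: mem_set.
Qed.

End Main.

Lemma cycle_means_uncolored (R : realType) (d : nat)
    (c : 'rV[int]_d -> 'I_1 -> 'I_1 -> R) (m0 : R) (i : 'I_1) :
  cycle_means c (fun=> m0) =
  [set of_lattice R x | x in supp_mu c (fun=> m0) i i].
Proof.
apply/seteqP; split=> [_ [q [j [x [q1 jx ->]]]]|_ [x ix <-]].
  have qE : q = 1%N by apply/eqP; rewrite eqn_leq andbC.
  subst q; exists (x ord0); last by rewrite big_ord1 invr1 scale1r.
  by have := jx ord0; rewrite !(ord1 i) !(ord1 (j _)).
exists 1%N, (fun=> i), (fun=> x); split => //.
by rewrite big_ord1 invr1 scale1r.
Qed.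

Theorem theorem2 (R : realType) (d p : nat) (d_gt0 : (0 < d)%N)
    (p_gt0 : (0 < p)%N) (c : 'rV[int]_d -> 'I_p -> 'I_p -> R) (m0 : R)
    (m0_gt1 : 1 < m0)
    (model : leaky_model c (fun=> m0))
    (finite_support : forall i j, finite_set [set x | c x i j != 0])
    (hA : assumptionA c (fun=> m0)) :
  let K := convex_hull (cycle_means c (fun=> m0)) in
  let h := radial K in
  let scaled_radius (m : R) (u : 'rV[R]_d) :=
    ln m / dot (Gamma_inv c (fun=> m) u) u in
  [/\ forall u, sphere u -> ray K u (h u) /\ ubound (ray K u) (h u),
      ereal_sup [set `|scaled_radius m u - h u|%:E | u in @sphere R d]
        @[m --> +oo] --> 0%E,
      hausdorff_dist (star_region (scaled_radius m)) K @[m --> +oo] --> 0%E &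
      p = 1%N -> forall i : 'I_p,
        K = convex_hull
              [set of_lattice R x | x in supp_mu c (fun=> m0) i i]].
Proof.
case: p p_gt0 c model finite_support hA => [//|n] _ c model finite_support hA.
move=> K h scaled_radius.
have irr := krw_irreducible hA.
have cK : compact K := compact_hull m0_gt1 model finite_support.
have vK : convex_set K by exact: convex_convex_hull.
have [la [C [la_bounds C0 la_ge la_le GammaP]]] :=
  exists_support_functions m0_gt1 model finite_support irr.
have la0 t : 0 < la t by have [] := la_bounds t.
have la_below t : - C <= ln (la t) by have [] := la_bounds t.
have Kn0 : K !=set0 by have [v Kv _] := la_le 0; exists v.
have K0 : K 0 := hull_contains0 cK vK Kn0 C0 la_below la_le.
have [B B0 KB] := compact_dot_bounded cK.
have radius_bounds m u : 1 < m -> sphere u ->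
    0 <= scaled_radius m u /\ `|scaled_radius m u - h u| <= B * C / ln m.
  move=> m1 u1; have [tm tmax] := GammaP m m1 u u1.
  have lm : 0 < ln m by rewrite ln_gt0.
  have [lo /andP[f0 fh]] :=
    support_bounds cK vK Kn0 la0 C0 la_below la_ge la_le m1 u1 tm tmax.
  split => //; rewrite ler0_norm ?subr_le0 // opprB ler_pdivlMr //.
  have hB : h u <= B.
    have [[h0 Kh] _] := radial_max cK K0 u1.
    by have := KB _ Kh; rewrite enormZ u1 mulr1 ger0_norm.
  (* [lo] says that [(h u - scaled_radius m u) * ln m] is at most [scaled_radius m u * C]; since the
     scaled radius is at most [h u <= B], the numerator of the error is independent of [m] and
     [u]. *)
  have fC : scaled_radius m u * C <= B * C by rewrite ler_wpM2r // (le_trans fh).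
  move: lo; rewrite -/(scaled_radius m u) -/h mulrDr mulrBl => lo; lra.
(* A point of the sphere, available because [d > 0], keeps the suprema from being [-oo]. *)
have [e e1] : exists e : 'rV[R]_d, sphere e.
  exists (delta_mx 0 (Ordinal d_gt0)).
  by rewrite /sphere /= /enorm dot_delta mxE !eqxx sqrtr1.
split.
- by move=> u; exact: radial_max.
- apply: (@cvg_le_inv_ln _ _ (B * C)) => m m1; apply/andP; split.
    apply: le_ereal_sup_tmp; exists `|scaled_radius m e - h e|%:E; first by exists e.
    by rewrite lee_fin normr_ge0.
  apply: ge_ereal_sup => _ [u u1 <-]; rewrite lee_fin.
  by have [] := radius_bounds m u m1 u1.
- apply: (@cvg_le_inv_ln _ _ (B * C)) => m m1.
  by apply: (hausdorff_radial cK vK K0 e1) => u u1; have [] := radius_bounds m u m1 u1.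
- move=> n0; case: n0 => n0; subst n => i.
  by rewrite /K (cycle_means_uncolored c m0 i).
Qed.
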